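(* Let $G$ be a strongly connected signed digraph on the vertex set $[n]=\{1,\dots,n\}$ without positive cycles. Then exactly one of the following holds (at least one holds): (i) $G$ is a cycle and no Boolean network on $G$ is synchronizing; or (ii) every and-or-net on $G$ has a synchronizing word of length at most $10(\sqrt{5}+1)^n$.
   Context: A signed digraph $G$ on a finite vertex set $V$ is a pair $(V,E)$ with $E\subseteq V\times V\times\{-1,1\}$; $(j,i,s)\in E$ is an arc from $j$ to $i$ of sign $s$ (loops are allowed, and both a positive and a negative arc from $j$ to $i$ may be present). Cycles are regarded as subgraphs without repeated vertices (a loop is a cycle of length one); the sign of a cycle is the product of the signs of its arcs. Graph notions not involving signs (strong connectivity, cycles as unsigned objects) refer to the underlying digraph. ''$G$ is a cycle'' means $G$ itself (as a graph) is a single cycle. A Boolean network (BN) with component set $V$ is a map $f:\{0,1\}^V\to\{0,1\}^V$, with $f_i(x)=f(x)_i$. Its signed interaction digraph has vertex set $V$ and a positive (resp. negative) arc from $j$ to $i$ iff there is $x$ with $x_j=0$ such that $f_i(x+e_j)-f_i(x)$ is positive (resp. negative), where $x+e_j$ is $x$ with component $j$ flipped. A BN on $G$ is a BN whose signed interaction digraph is $G$. A BN $f$ on $G$ is an and-or-net if for each $i$ either $f_i$ is a conjunction ($f_i(x)=1$ iff $x_j=1$ for every positive in-neighbor $j$ of $i$ and $x_j=0$ for every negative in-neighbor $j$ of $i$) or a disjunction ($f_i(x)=0$ iff $x_j=0$ for every positive in-neighbor $j$ and $x_j=1$ for every negative in-neighbor $j$). For $i\in V$, $f^i(x)$ is obtained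 from $x$ by replacing $x_i$ by $f_i(x)$. For a word $w=i_1\cdots i_\ell$ over $V$, $f^w=f^{i_\ell}\circ\cdots\circ f^{i_1}$ ($f^\epsilon$ is the identity). A word $w$ is synchronizing for $f$ if $f^w$ is constant; $f$ is synchronizing if it has a synchronizing word. *)

(* Defs.v *)
From mathcomp Require Import all_boot.
From Stdlib Require Import Reals.
Set Implicit Arguments. Unset Strict Implicit. Unset Printing Implicit Defensive.

(* Vertex set [n] is modelled as 'I_n.  A sign s in {-1,1} is modelled as a
   boolean: true = +1 (positive), false = -1 (negative).
   A signed digraph is its arc set E : {set 'I_n * 'I_n * bool}; the triple
   (j, i, s) is an arc from j to i of sign s. *)
Definition sdigraph (n : nat) := {set 'I_n * 'I_n * bool}.

Definition adj n (E : sdigraph n) : rel 'I_n :=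
  fun j i => ((j, i, true) \in E) || ((j, i, false) \in E).

Definition strongly_connected n (E : sdigraph n) : Prop :=
  forall u v : 'I_n, connect (adj E) u v.

(* A cycle is given by the cyclic list of its vertices v_0..v_{k-1} together
   with the sign s_t of the chosen arc from v_t to v_{t+1 mod k}. *)
Definition cycle_arcs n (c : seq ('I_n * bool)) : seq ('I_n * 'I_n * bool) :=
  [seq (p.1.1, p.2.1, p.1.2) | p <- zip c (rot 1 c)].

Definition is_cycle n (E : sdigraph n) (c : seq ('I_n * bool)) : bool :=
  [&& c != [::], uniq (map fst c) & all (fun a => a \in E) (cycle_arcs c)].

(* sign of a cycle: product of arc signs; positive iff even number of negative arcs *)
Definition positive_cycle n (c : seq ('I_n * bool)) : bool :=
  ~~ odd (count (fun p => ~~ p.2) c).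

Definition no_positive_cycle n (E : sdigraph n) : Prop :=
  forall c, is_cycle E c -> ~~ positive_cycle c.

Definition graph_is_cycle n (E : sdigraph n) : Prop :=
  exists c, [/\ is_cycle E c, E = [set a in cycle_arcs c] &
                forall v : 'I_n, v \in map fst c].

Definition state n := {ffun 'I_n -> bool}.
Definition BN n := state n -> state n.

Definition flip n (x : state n) (j : 'I_n) : state n :=
  [ffun k => if k == j then ~~ x k else x k].

Definition pos_arc n (f : BN n) (j i : 'I_n) : Prop :=
  exists x : state n, x j = false /\ f x i = false /\ f (flip x j) i = true.
Definition neg_arc n (f : BN n) (j i : 'I_n) : Prop :=
  exists x : state n, x j = false /\ f x i = true /\ f (flip x j) i = false.

Definition BN_on n (E : sdigraph n) (f : BN n) : Prop :=
  forall j i : 'I_n,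
    ((j, i, true) \in E <-> pos_arc f j i) /\ ((j, i, false) \in E <-> neg_arc f j i).

Definition conj_at n (E : sdigraph n) (f : BN n) (i : 'I_n) : Prop :=
  forall x : state n,
    f x i = [forall j, (((j, i, true) \in E) ==> x j) &&
                       (((j, i, false) \in E) ==> ~~ x j)].
Definition disj_at n (E : sdigraph n) (f : BN n) (i : 'I_n) : Prop :=
  forall x : state n,
    f x i = [exists j, (((j, i, true) \in E) && x j) ||
                       (((j, i, false) \in E) && ~~ x j)].

Definition and_or_net n (E : sdigraph n) (f : BN n) : Prop :=
  BN_on E f /\ forall i, conj_at E f i \/ disj_at E f i.

Definition upd n (f : BN n) (i : 'I_n) (x : state n) : state n :=
  [ffun k => if k == i then f x i else x k].
Definition fword n (f : BN n) (w : seq 'I_n) (x : state n) : state n :=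
  foldl (fun y i => upd f i y) x w.

Definition synchronizing_word n (f : BN n) (w : seq 'I_n) : Prop :=
  exists c : state n, forall x, fword f w x = c.
Definition synchronizing n (f : BN n) : Prop :=
  exists w, synchronizing_word f w.

Definition length_bound (n len : nat) : Prop :=
  (INR len <= 10 * (sqrt 5 + 1) ^ n)%R.

(* Main.v *)
From Stdlib Require Import Reals Lra Lia Classical.
Require Import Defs.
From mathcomp Require Import all_boot zify.
Set Implicit Arguments. Unset Strict Implicit. Unset Printing Implicit Defensive.

(** Switching each variable by the kind of its local function turns an
and-or-net into a network of conjunctions of literals.  Without positive
cycles, no labelling g of the vertices has a cycle of arcs j -> i that are
consistent, i.e. whose literal evaluated at g j equals g i.  Hence, if every
vertex is reached from o by consistent arcs, all literals entering o are false
when g o = 1 and true when g o = 0: some word reverses the literals of o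
without touching o, at a cost governed by a Fibonacci-like recurrence.

Two states are then synchronized on a growing set.  On the remaining set W,
one finds a root o and a pocket K of vertices that follow o.  If at least two
arcs of W enter o, its literals are first made false in one of the states;
while making one of them false in the other state, a second one stays false in
the first state, so that updating o sets it to 0 in both.  Then K follows o,
and K is removed from W.  If only pocket vertices enter o, the pocket evolves
by itself and is synchronized in linear time.  Vertices all of whose ancestors
have in-degree one are carried along, as they can never be merged later; that
the graph is not a cycle means that there are none at the beginning.

The number of states is at most a half (or three quarters) of 2^n after the
first letter, and each merge of two states lowers it by one. *)

(** * Reachability in finite digraphs *)

Section Connectivity.
Variables (T : finType).
Implicit Types (e : rel T) (D : {set T}).

Lemma connect_cross e (p : pred T) u v :
  connect e u v -> p u -> ~~ p v ->
  exists a b, [/\ connect e u a, connect e b v, e a b, p a & ~~ p b].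
Proof.
case/connectP=> s; elim: s u => [|y s IHs] u /=.
  by move=> _ -> -> .
case/andP=> euy ys vE pu pv; case: (boolP (p y)) => py.
  have [a [b [ca cb eab pa pb]]] := IHs y ys vE py pv.
  by exists a, b; split=> //; apply: connect_trans ca; apply: connect1.
by exists u, y; split=> //; apply/connectP; exists s.
Qed.

Definition restr D e : rel T := fun a b => [&& a \in D, b \in D & e a b].

Lemma restr_sub D e : subrel (restr D e) e.
Proof. by move=> a b /and3P[]. Qed.

Lemma connect_sub_rel e e' : subrel e e' -> subrel (connect e) (connect e').
Proof. by move=> s; apply: connect_sub => a b /s; apply: connect1. Qed.

Lemma connect_step e a b c : connect e a b -> e b c -> connect e a c.
Proof. by move=> cab /connect1; apply: connect_trans. Qed.

(** A vertex with the fewest ancestors in [D] works: any of its ancestors in [D] has no other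
    ancestors, hence exactly the same ones. *)
Lemma source_exists e D t : t \in D ->
  exists2 s, s \in D & forall u, u \in D -> connect e u s -> connect e s u.
Proof.
move=> tD; pose anc s := [set u in D | connect e u s].
case: (arg_minnP (fun s => #|anc s|) tD) => s sD0 min.
have sD : s \in D by exact: sD0.
exists s => // u uD cus.
have sub : anc u \subset anc s.
  apply/subsetP=> a; rewrite !inE => /andP[-> cau] /=; exact: connect_trans cus.
have /eqP eqa : anc u == anc s by rewrite eqEcard sub min.
have : s \in anc s by rewrite inE sD connect0.
by rewrite -eqa inE => /andP[].
Qed.

End Connectivity.

(* Length bound for the words of run_lemma, for m updatable vertices and t held
   ones.  In the maximum, the first entry is a recursive call used to flip a
   vertex w, where an out-neighbour of w can be set to 0 before or after the
   flip; in the second entry that out-neighbour is held, and visited for free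
   both times. *)
Fixpoint runcost (m t : nat) {struct m} : nat :=
  match m with
  | 0 => 0
  | 1 => 1
  | (m'.+1 as p).+1 =>
      maxn (runcost p t + runcost m' t + 2)
           (if t is t'.+1 then 2 * runcost p t' + 1 else 0)
  end.

Lemma runcostS m t :
  runcost m.+2 t = maxn (runcost m.+1 t + runcost m t + 2)
           (if t is t'.+1 then 2 * runcost m.+1 t' + 1 else 0).
Proof. by []. Qed.

Lemma runcost_incr m t : (runcost m t).+1 <= runcost m.+1 t.
Proof.
case: m => [//|m]; rewrite runcostS; apply: leq_trans (leq_maxl _ _).
by rewrite addn2 ltnS -addnS leq_addr.
Qed.

Lemma runcost_mono m m' t t' : m <= m' -> t <= t' -> runcost m t <= runcost m' t'.
Proof.
move=> mm tt; apply: (@leq_trans (runcost m t')).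
  elim/ltn_ind: m t t' tt {mm m'} => -[|[|m]] IH t t' tt //.
  rewrite !runcostS geq_max !leq_max leq_add2r leq_add ?IH //=.
  case: t tt => [|t] //=; case: t' => // t' tt.
  by rewrite leq_add2r leq_mul2l (IH m.+1) ?orbT.
rewrite -(subnKC mm); elim: (m' - m) => [|k IH]; first by rewrite addn0.
by rewrite addnS (leq_trans IH) // (leq_trans _ (runcost_incr _ _)).
Qed.

(** * Networks of conjunctions of literals *)

Section Net.
Variables (V : finType) (A : rel V) (sg : V -> V -> bool).
Notation st := {ffun V -> bool}.
Implicit Types (x y : st) (g : V -> bool) (W P H S K Cs : {set V}).

(* [sg j i] is the value of j that makes the literal of j in the conjunction at
   i true. *)
Definition lit g j i := g j == sg j i.
Definition F x i := [forall j, A j i ==> lit x j i].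
Definition up x i : st := [ffun k => if k == i then F x i else x k].
Definition run w x := foldl up x w.
Definition con g : rel V := fun j i => A j i && (lit g j i == g i).
Definition setv g b c : V -> bool := fun k => if k == b then c else g k.

Lemma upE x i k : up x i k = if k == i then F x i else x k.
Proof. by rewrite ffunE. Qed.

Lemma run_cat w1 w2 x : run (w1 ++ w2) x = run w2 (run w1 x).
Proof. exact: foldl_cat. Qed.

Lemma run_rcons w i x : run (rcons w i) x = up (run w x) i.
Proof. exact: foldl_rcons. Qed.

Lemma run_notin w x k : k \notin w -> run w x k = x k.
Proof.
elim: w x => [//|i w IH] x; rewrite inE negb_or => /andP[ki kw] /=.
by rewrite IH // upE (negbTE ki).
Qed.

Lemma all_notin W w k : all (mem W) w -> k \notin W -> k \notin w.
Proof. by move=> /allP wW; apply: contra => /wW. Qed.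

Lemma run_out W w x k : all (mem W) w -> k \notin W -> run w x k = x k.
Proof. by move=> wW kW; apply: run_notin; apply: all_notin kW. Qed.

Lemma all_subset W W' w : W \subset W' -> all (mem W) w -> all (mem W') w.
Proof. by move=> /subsetP s /allP a; apply/allP => k /a /s. Qed.

Lemma litE g g' j i : g j = g' j -> lit g j i = lit g' j i.
Proof. by rewrite /lit => ->. Qed.

Lemma Ffalse x j i : A j i -> ~~ lit x j i -> F x i = false.
Proof.
by move=> a /negbTE l; apply/negbTE/forallPn; exists j; rewrite a l.
Qed.

Lemma Ftrue x i : (forall j, A j i -> lit x j i) -> F x i = true.
Proof. by move=> h; apply/forallP=> j; apply/implyP; apply: h. Qed.

(** * Labellings that tie a whole region to a root by consistent arcs *)

Hypothesis NP : forall g j i, con g j i -> connect (con g) i j -> False.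

Definition conP P g : rel V := restr P (con g).

Lemma conP_con P g : subrel (connect (conP P g)) (connect (con g)).
Proof. by apply: connect_sub_rel; apply: restr_sub. Qed.

(** If the literal agreed with [g i], the arc would close a consistent cycle. This is how
    reachability from [i] controls the literals entering [i]. *)
Lemma NP_lit g j i : A j i -> connect (con g) i j -> lit g j i = ~~ g i.
Proof.
move=> a c; case E: (lit g j i == g i).
  by case: (@NP g j i) => //; rewrite /con a E.
by move: E; case: (lit _ _ _); case: (g i).
Qed.

Lemma eq_conP P g g' : {in P, g' =1 g} -> conP P g =2 conP P g'.
Proof.
move=> e a b; rewrite /conP /restr /con.
case aP: (a \in P) => //=; case bP: (b \in P) => //=.
by rewrite e // (litE _ (e _ aP)).
Qed.

(* P is the explored part, tied to v by arcs consistent with the labels g; W is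
   the set of vertices that may be updated, and the other vertices are held. *)
Definition runnable H v P W g x :=
  [/\ [/\ v \in P, P \subset H, W \subset H & [disjoint P & W]],
      (forall h, h \in H -> connect (restr H A) v h),
      (forall p, p \in P -> connect (conP P g) v p),
      (forall d b, A d b -> b \in W -> d \notin W ->
          lit x d b \/ (d \in P /\ g d = x d)) &
      (forall b, b \in W -> exists2 d, A d b & d \in W \/ (d \in P /\ g d = x d))].

(** Outside [P] and [W] the labels [g'] need not match the state: held vertices are labelled freely,
    without any update. *)
Definition labelled H v P W g x N :=
  exists w g', [/\ all (mem W) w, size w <= N, {in P, g' =1 g},
     (forall h, h \in H -> connect (conP H g') v h) &
     {in W, forall e, g' e = run w x e}].

Lemma runnable_run H v P W g x w0 :
  all (mem W) w0 -> runnable H v P W g x -> runnable H v P W g (run w0 x).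
Proof.
move=> w0W [[vP PH WH PW] r1 r2 r3 r4]; split=> //.
- move=> d b a bW dW; rewrite (run_out _ w0W dW).
  case: (r3 _ _ a bW dW) => [l|]; last by right.
  by left; rewrite (@litE _ x) // (run_out _ w0W).
- move=> b bW; have [d a [dW|[dP e]]] := r4 b bW; exists d => //; first by left.
  by right; split=> //; rewrite (run_out _ w0W) // (disjointFr PW).
Qed.

Lemma labelled_run H v P W g x w0 N :
  all (mem W) w0 -> labelled H v P W g (run w0 x) N ->
  labelled H v P W g x (size w0 + N).
Proof.
move=> w0W [w [g' [wW sw e1 c e2]]]; exists (w0 ++ w), g'; split=> //.
- by rewrite all_cat w0W.
- by rewrite size_cat leq_add2l.
by move=> e eW; rewrite run_cat e2.
Qed.

Lemma labelled_leq H v P W g x N N' :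
  N <= N' -> labelled H v P W g x N -> labelled H v P W g x N'.
Proof.
move=> NN [w [g' [? s ? ? ?]]]; exists w, g'; split=> //; exact: leq_trans NN.
Qed.

Lemma runnable_ext H v P W g x d b :
  runnable H v P W g x -> b \in H -> b \notin P -> d \in P -> A d b ->
  (b \in W -> x b = lit g d b) ->
  runnable H v (b |: P) (W :\ b) (setv g b (lit g d b)) x.
Proof.
move=> [[vP PH WH PW] r1 r2 r3 r4] bH bP dP adb xb.
have neqb k : k \in P -> (k == b) = false.
  by move=> kP; apply/negbTE; apply: contraNneq bP => <-.
have geq : {in P, setv g b (lit g d b) =1 g} by move=> k kP; rewrite /setv neqb.
have sub p q : connect (conP P g) p q ->
    connect (conP (b |: P) (setv g b (lit g d b))) p q.
  apply: connect_sub_rel => j i; rewrite (eq_conP geq) => /and3P[jP iP c].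
  by rewrite /conP /restr !inE jP iP !orbT.
split.
- split; first by rewrite !inE vP orbT.
  + by rewrite subUset sub1set bH.
  + by apply: subset_trans WH; apply: subsetDl.
  + apply/pred0P=> k /=; rewrite !inE; case: (eqVneq k b) => //= _.
    by case kP: (k \in P) => //=; apply: (disjointFr PW).
- exact: r1.
- move=> p; rewrite !inE => /orP[/eqP->|pP]; last by apply/sub/r2.
  apply: (@connect_step _ _ _ d); first by apply/sub/r2.
  rewrite /conP /restr !inE dP eqxx orbT /= /con adb /=.
  by rewrite {2}/setv eqxx (litE _ (geq _ dP)).
- move=> d' b' a; rewrite !inE => /andP[b'b b'W]; rewrite negb_and negbK.
  case: (eqVneq d' b) a => [->|db] a /= => [_|d'W].
    case: (boolP (b \in W)) => bW; first by right; rewrite /setv eqxx xb.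
    by case: (r3 _ _ a b'W bW) => [|[bP' _]]; [left|rewrite bP' in bP].
  case: (r3 _ _ a b'W d'W) => [|[dP' e]]; first by left.
  by right; rewrite dP' geq.
- move=> b'; rewrite !inE => /andP[b'b b'W].
  have [d' a [d'W|[dP' e]]] := r4 _ b'W; exists d' => //; rewrite !inE.
    case: (eqVneq d' b) => [E|db]; last by left.
    by right; rewrite /setv E eqxx -xb // -E.
  by right; rewrite dP' orbT geq.
Qed.

Lemma labelled_ext H v P W g x b c N :
  b \notin P -> (b \in W -> x b = c) ->
  labelled H v (b |: P) (W :\ b) (setv g b c) x N -> labelled H v P W g x N.
Proof.
move=> bP xb [w [g' [wW sw e1 cn e2]]]; exists w, g'; split=> //.
- by apply: all_subset wW; apply: subsetDl.
- move=> k kP; rewrite e1 ?inE ?kP ?orbT // /setv.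
  by case: eqP => // E; rewrite -E kP in bP.
move=> e eW; case: (eqVneq e b) => [E|eb]; last by rewrite e2 // !inE eb.
subst e; rewrite e1 ?inE ?eqxx // /setv eqxx -xb //; symmetry.
by apply: run_out wW _; rewrite !inE eqxx.
Qed.

(** By the clauses of [runnable], a false literal entering [W] comes from the explored part;
    updating [b] gives 0, the very label that makes the arc from [d] consistent. *)
Lemma labelled_zero H v P W g x d b N :
  runnable H v P W g x -> b \in W -> d \notin W -> A d b -> ~~ lit x d b ->
  (forall g' x', runnable H v (b |: P) (W :\ b) g' x' ->
     labelled H v (b |: P) (W :\ b) g' x' N) ->
  labelled H v P W g x N.+1.
Proof.
move=> ok bW dW adb l IH.
have bw : all (mem W) [:: b] by rewrite /= bW.
have ok1 := runnable_run bw ok.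
have [[_ PH WH PW] _ _ r3 _] := ok.
have bP : b \notin P by rewrite (disjointFl PW).
have [dP gd] : d \in P /\ g d = x d by case: (r3 _ _ adb bW dW) l => [->|].
have ld : lit g d b = false by rewrite (litE _ gd) (negbTE l).
have xb : up x b b = lit g d b by rewrite upE eqxx ld (Ffalse adb).
rewrite -add1n; apply: (labelled_run bw) => /=.
apply: (@labelled_ext _ _ _ _ _ _ b (lit g d b)) => //; apply: IH.
by apply: runnable_ext => //; apply: (subsetP WH).
Qed.

Lemma restr_closed (T : finType) (e : rel T) (D S : {set T}) (a b : T) :
  (forall a b, a \in D -> b \in S -> e a b -> a \in S) ->
  connect (restr D e) a b -> b \in S -> connect (restr S e) a b.
Proof.
move=> cl /connectP[p]; elim: p a => [|c p IH] a /=; first by move=> _ ->.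
case/andP=> /and3P[aD cD eac] pp lE bS.
have ccb := IH _ pp lE bS.
have cS : c \in S.
  case/connectP: ccb => [[|d q]] /=; first by move=> _ <-.
  by case/andP=> /and3P[].
apply: connect_trans ccb; apply: connect1.
by rewrite /restr cS eac (cl a c).
Qed.

Lemma setD_shift (T : finType) (D P W : {set T}) b :
  D :\: (b |: P) :\: (W :\ b) = (D :\: P :\: W) :\ b.
Proof.
apply/setP=> e; rewrite !inE.
by case: (eqVneq e b) => //= _; case: (e \in W).
Qed.

(** Induction on the number of vertices of [H] left to explore. A vertex whose label is obtained by
    at most one update is explored at once; the costly case is a vertex with the wrong value that
    has to be toggled. *)
Lemma run_lemma k : forall H v P W g x, #|H :\: P| <= k ->
  runnable H v P W g x ->
  labelled H v P W g x (runcost #|W| #|H :\: P :\: W|).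
Proof.
elim/ltn_ind: k => k IH H v P W g x Hk ok.
have IHlt H' v' P' W' g' x' : #|H' :\: P'| < #|H :\: P| -> runnable H' v' P' W' g' x' ->
    labelled H' v' P' W' g' x' (runcost #|W'| #|H' :\: P' :\: W'|).
  by move=> lt; apply: (IH #|H' :\: P'|) => //; apply: leq_trans Hk.
clear IH k Hk; have [[vP PH WH PW] r1 r2 r3 r4] := ok.
have WnP b : b \in W -> b \notin P by move=> bW; rewrite (disjointFl PW).
have ltP b : b \in H -> b \notin P -> #|H :\: (b |: P)| < #|H :\: P|.
  move=> bH bP; apply: proper_card; apply/properP; split.
    by apply: setDS; apply: subsetUr.
  by exists b; rewrite !inE ?bH ?bP ?eqxx.
have eqt b : b \in W -> H :\: (b |: P) :\: (W :\ b) = H :\: P :\: W.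
  move=> bW; apply/setP=> e; rewrite !inE; case: (eqVneq e b) => //= ->.
  by rewrite bW.
have leW b : b \in W -> #|W :\ b|.+1 = #|W| by move=> bW; rewrite (cardsD1 b W) bW.
(* The head of an arc with a false literal entering W can be set to 0. *)
case: (pickP [pred p : V * V | [&& A p.1 p.2, p.2 \in W, p.1 \notin W & ~~ lit x p.1 p.2]]).
  case=> d b /= /and4P[adb bW dW l].
  apply: labelled_leq (labelled_zero ok bW dW adb l (N := runcost #|W :\ b| #|H :\: P :\: W|) _).
    by rewrite -(leW b bW) runcost_incr.
  move=> g' x' ok'; rewrite -(eqt b bW); apply: IHlt => //.
  by apply: ltP; rewrite ?WnP // (subsetP WH).
move=> noa0; have noa d b : A d b -> b \in W -> d \notin W -> lit x d b.
  by move=> a bW dW; have := noa0 (d, b); rewrite /= a bW dW /= => /negbFE.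
clear noa0.
(* All literals entering W are true: a vertex of W without in-neighbour in W
   can be set to 1. *)
case: (pickP [pred b | (b \in W) && [forall d, A d b ==> (d \notin W)]]).
  move=> b /andP[bW /forallP nb].
  have [d adb [dW|[dP gd]]] := r4 _ bW.
    by have := nb d; rewrite adb dW.
  have l d' : A d' b -> lit x d' b.
    by move=> a; apply: noa => //; have := nb d'; rewrite a.
  have bw : all (mem W) [:: b] by rewrite /= bW.
  apply: (@labelled_leq _ _ _ _ _ _ (1 + runcost #|W :\ b| #|H :\: P :\: W|)).
    by rewrite add1n -(leW b bW) runcost_incr.
  apply: (labelled_run bw) => /=.
  have xb : up x b b = lit g d b by rewrite upE eqxx Ftrue // (litE _ gd) l.
  apply: (@labelled_ext _ _ _ _ _ _ b (lit g d b)); rewrite ?WnP //.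
  rewrite -(eqt b bW); apply: IHlt.
    by apply: ltP; rewrite ?WnP // (subsetP WH).
  have ok1 := runnable_run bw ok.
  by apply: runnable_ext; rewrite ?WnP // (subsetP WH).
move=> nob0; have nob b : b \in W -> exists2 d, A d b & d \in W.
  move=> bW; have := nob0 b; rewrite /= bW /= => /forallPn[d].
  by rewrite negb_imply negbK => /andP[a dW]; exists d.
clear nob0.
case: (set_0Vmem (H :\: P)) => [HP0|[t0 t0T]].
  have W0 : W = set0.
    by apply/setP=> e; rewrite inE; apply/negP=> eW; have := in_set0 e;
      rewrite -HP0 inE WnP // (subsetP WH).
  have EH : H = P by apply/eqP; rewrite eqEsubset PH andbT -setD_eq0 HP0.
  exists [::], g; split=> //; first by move=> h hH; rewrite EH; apply: r2; rewrite -EH.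
  by move=> e; rewrite W0 inE.
(* [S] will be a source component of the unexplored part: it is strongly connected, and an arc from
   [H] into it starts in [S] or in [P]. *)
pose T := H :\: P; pose R := restr T A.
have [s sT smin] := source_exists R t0T.
pose S := [set u in T | connect R u s].
have ST u : u \in S -> u \in T by rewrite inE => /andP[].
have SP u : u \in S -> u \notin P by move/ST; rewrite inE => /andP[].
have SH u : u \in S -> u \in H by move/ST; rewrite inE => /andP[].
have Scl a b : a \in T -> b \in S -> A a b -> a \in S.
  move=> aT bS ab; rewrite inE aT /=; have := bS; rewrite inE => /andP[bT].
  by apply: connect_trans; apply: connect1; rewrite /R /restr aT bT.
have Sstr a b : a \in S -> b \in S -> connect (restr S A) a b.
  move=> aS bS; apply: (restr_closed (D := T)) => //.
  move: aS bS; rewrite !inE => /andP[_ cas] /andP[bT cbs].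
  by apply: connect_trans cas _; apply: smin => //; rewrite !inE.
have sS : s \in S by rewrite inE sT connect0.
(* Since [v] reaches [s] inside [H], some arc goes from [P] into [S]; it prescribes the label [c] of
   its head [w]. *)
have [d [w [_ _ /and3P[dH wH adw] /= dS /negPn wS]]] :
    exists a b, [/\ connect (restr H A) v a, connect (restr H A) b s, restr H A a b,
      a \notin S & ~~ (b \notin S)].
  apply: (connect_cross (p := [pred u | u \notin S]) (r1 s (SH _ sS))) => /=.
    by apply: contraL vP => /SP.
  by rewrite sS.
have dP : d \in P.
  by apply: contraNT dS => dP; apply: (Scl _ w) => //; rewrite inE dP.
pose c := lit g d w.
have wP := SP _ wS.
case: (boolP (w \in W)) => wW; last first.
  apply: (@labelled_ext _ _ _ _ _ _ w c); rewrite ?(negbTE wW) //.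
  have EW : W :\ w = W by apply/setDidPl; rewrite disjoint_sym disjoints1.
  apply: (@labelled_leq _ _ _ _ _ _ (runcost #|W :\ w| #|H :\: (w |: P) :\: (W :\ w)|)).
    rewrite EW; apply: runcost_mono => //; apply: subset_leq_card.
    by apply: setSD; apply: setDS; apply: subsetUr.
  apply: IHlt; first exact: ltP.
  by apply: runnable_ext => //; rewrite (negbTE wW).
case: (eqVneq (x w) c) => xw.
  apply: (@labelled_ext _ _ _ _ _ _ w c) => //.
  apply: (@labelled_leq _ _ _ _ _ _ (runcost #|W :\ w| #|H :\: (w |: P) :\: (W :\ w)|)).
    by rewrite eqt // runcost_mono // subset_leq_card // subsetDl.
  by apply: IHlt; [exact: ltP | apply: runnable_ext].
(* Otherwise w is flipped: a recursive call inside the source component S gives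
   all literals from W at w the value ~~ x w. *)
pose W1 := W :&: S :\ w.
have ok1 : runnable S w [set w] W1 x x.
  split.
  - split; rewrite ?inE ?sub1set //; first by apply/subsetP=> e; rewrite !inE => /andP[_ /andP[_ ->]].
    by rewrite disjoints1 !inE eqxx.
  - by move=> h hS; apply: Sstr.
  - by move=> p; rewrite inE => /eqP->; apply: connect0.
  - move=> d' b a; rewrite in_setD1 in_setI => /and3P[bw bW bS] d'W1.
    case: (eqVneq d' w) => [->|d'w]; first by right; rewrite inE.
    left; apply: noa => //; apply: contra d'W1 => d'W; rewrite !in_setD1 in_setI d'w d'W /=.
    by apply: (Scl _ b) => //; rewrite inE WnP // (subsetP WH).
  - move=> b; rewrite in_setD1 in_setI => /and3P[bw bW bS].
    have [d' a d'W] := nob _ bW; exists d' => //.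
    case: (eqVneq d' w) => [->|d'w]; first by right; rewrite inE.
    left; rewrite in_setD1 in_setI d'w d'W.
    by apply: (Scl _ b) => //; rewrite inE WnP // (subsetP WH).
have W1W : W1 \subset W by apply/subsetP=> e; rewrite !inE => /andP[_ /andP[]].
have toggle N1 N2 : labelled S w [set w] W1 x x N1 ->
    (forall w0, all (mem W) w0 -> run w0 x w = c ->
       runnable H v (w |: P) (W :\ w) (setv g w c) (run w0 x) ->
       labelled H v (w |: P) (W :\ w) (setv g w c) (run w0 x) N2) ->
    labelled H v P W g x (N1 + 1 + N2).
  case=> w1 [g1 [w1W sw1 e1 c1 e2]] h2.
  have w1W' : all (mem W) w1 by apply: all_subset w1W.
  have g1w : g1 w = x w by apply: e1; rewrite inE.
  have litW j : A j w -> j \in W -> lit (run w1 x) j w = ~~ x w.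
    move=> a jW; have jS : j \in S.
      by apply: (Scl _ w) => //; rewrite inE WnP // (subsetP WH).
    rewrite -g1w -(@NP_lit g1 j w) //; last exact/conP_con/c1.
    case: (eqVneq j w) => [->|jw].
      by apply: litE; rewrite g1w (run_out _ w1W) // !inE eqxx.
    by apply: litE; rewrite e2 // in_setD1 in_setI jw jW jS.
  have Fw : F (run w1 x) w = c.
    have -> : c = ~~ x w by move: xw; rewrite /c; case: (lit _ _ _); case: (x w).
    case E: (~~ x w).
      apply: Ftrue => j a; case: (boolP (j \in W)) => jW; first by rewrite litW.
      by rewrite (@litE _ x) ?noa // (run_out _ w1W').
    by have [j a jW] := nob _ wW; apply: (Ffalse a); rewrite litW // E.
  have wsW : all (mem W) (rcons w1 w) by rewrite all_rcons /= wW.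
  have rw : run (rcons w1 w) x w = c by rewrite run_rcons upE eqxx.
  apply: (@labelled_leq _ _ _ _ _ _ (size (rcons w1 w) + N2)).
    by rewrite size_rcons leq_add2r addn1 ltnS.
  apply: (labelled_run wsW); apply: (@labelled_ext _ _ _ _ _ _ w c) => //.
  apply: h2 => //; apply: runnable_ext => //; exact: runnable_run.
have T1le b : b \in S -> b != w -> #|S :\: [set w]| < #|H :\: P|.
  move=> _ _; apply: (@leq_trans #|S|); last by apply/subset_leq_card/subsetP=> e /ST.
  by rewrite [X in _ < X](cardsD1 w) wS.
have ltS : #|S :\: [set w]| < #|H :\: P|.
  apply: (@leq_trans #|S|); last by apply/subset_leq_card/subsetP=> e /ST.
  by rewrite [X in _ < X](cardsD1 w) wS.
clear T1le.
have tS : S :\: [set w] :\: W1 \subset H :\: P :\: W.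
  apply/subsetP=> e; rewrite /W1 in_setD !in_setD1 in_setI.
  move=> /andP[h1 /andP[ew eS]]; rewrite !in_setD SP // SH // !andbT.
  by apply: contra h1 => ->; rewrite ew eS.
have W1w : W1 \subset W :\ w by apply: setSD; apply: subsetIl.
set t := #|H :\: P :\: W|.
have phase2 w0 N : runcost #|W :\ w| t <= N ->
    runnable H v (w |: P) (W :\ w) (setv g w c) (run w0 x) ->
    labelled H v (w |: P) (W :\ w) (setv g w c) (run w0 x) N.
  by move=> le ok2; apply: labelled_leq le _; rewrite /t -(eqt w) //; apply: IHlt => //; apply: ltP.
have phase1 : labelled S w [set w] W1 x x (runcost #|W :\ w| t).
  apply: labelled_leq (IHlt _ _ _ _ _ _ ltS ok1).
  by apply: runcost_mono; apply: subset_leq_card.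
have [eqS|[b [bS bw awb]]] :
    S = [set w] \/ exists b, [/\ b \in S, b != w & A w b].
  case: (set_0Vmem (S :\ w)) => [S0|[u]].
    by left; apply/setP=> e; rewrite inE; case: eqVneq => [->//|ew];
      have := in_set0 e; rewrite -S0 in_setD1 ew.
  rewrite in_setD1 => /andP[uw uS]; right.
  have [a [b [_ _ /and3P[_ bS ab] /eqP aw bw]]] :=
    connect_cross (p := pred1 w) (Sstr w u wS uS) (eqxx w) uw.
  by exists b; split=> //; rewrite -aw.
- have W10 : W1 = set0.
    by apply/setP=> e; rewrite /W1 eqS !inE; case: eqP; rewrite ?andbF.
  apply: labelled_leq (toggle 0 (runcost #|W :\ w| t) _ _).
  + by rewrite addn1 add1n -(leW w wW) runcost_incr.
  + by have := IHlt _ _ _ _ _ _ ltS ok1; rewrite {2}W10 cards0.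
  + by move=> w0 _ _; apply: phase2.
have bP := SP _ bS; have bH := SH _ bS.
have bwP : b \notin w |: P by rewrite !inE negb_or bw.
have wbT : #|S :\: (b |: [set w])| < #|H :\: P|.
  by apply: leq_ltn_trans ltS; apply/subset_leq_card/setDS/subsetUr.
have wbP : #|H :\: (b |: (w |: P))| < #|H :\: P|.
  by apply: leq_ltn_trans (ltP _ wH wP); apply/subset_leq_card/setDS/subsetUr.
case: (boolP (b \in W)) => bW.
  have bW1 : b \in W1 by rewrite in_setD1 in_setI bw bW bS.
  have bWw : b \in W :\ w by rewrite !inE bw.
  have cW : #|W| = #|W :\ w :\ b|.+2 by rewrite -(leW w wW) (cardsD1 b (W :\ w)) bWw.
  have cWw : #|W :\ w| = #|W :\ w :\ b|.+1 by rewrite (cardsD1 b (W :\ w)) bWw.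
  set r := runcost #|W :\ w :\ b| t.
  have costE : runcost #|W :\ w| t + r + 2 <= runcost #|W| t.
    by rewrite cWw cW runcostS leq_maxl.
  (* Toggling [w] switches its literal at [b]. If it is true now, the second call starts by setting
     [b] to 0; otherwise the first call does. *)
  case: (boolP (lit x w b)) => l.
    apply: labelled_leq (toggle (runcost #|W :\ w| t) r.+1 _ _) => //.
      by apply: leq_trans costE; rewrite addn1 addnS addSn addn2.
    move=> w0 w0W rw ok2; apply: (labelled_zero (d := w) (b := b)) ok2 _ _ _ _ _ => //.
    - by rewrite !inE eqxx.
    - have -> : lit (run w0 x) w b = ~~ lit x w b; last by rewrite l.
      by rewrite /lit rw; move: xw; move: (x w) (c) (sg w b) => [] [] [].
    move=> g' x' ok'; apply: labelled_leq (IHlt _ _ _ _ _ _ wbP ok').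
    by apply: runcost_mono => //; rewrite !setD_shift; apply/subset_leq_card/(subset_trans (subsetDl _ _))/subsetDl.
  apply: labelled_leq (toggle r.+1 (runcost #|W :\ w| t) _ _).
  - by apply: leq_trans costE; rewrite addn1 addSn addnC addnS addn2.
  - have wW1 : w \notin W1 by rewrite !inE eqxx.
    apply: (labelled_zero (d := w) (b := b)) ok1 _ _ _ _ _ => //.
    move=> g' x' ok'; apply: labelled_leq (IHlt _ _ _ _ _ _ wbT ok').
    apply: runcost_mono; apply/subset_leq_card; first exact: setSD.
    by rewrite setD_shift; apply: subset_trans tS; apply: subsetDl.
  by move=> w0 _ _; apply: phase2.
(* Here [b] is held, hence labelled for free at the start of both calls, each of which has one
   unexplored held vertex fewer. *)
have t_gt0 : t = #|(H :\: P :\: W) :\ b|.+1.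
  by rewrite /t (cardsD1 b) !inE bW bP bH.
set t' := #|_ :\ b| in t_gt0.
have bW1 : b \notin W1 by apply: contra bW; apply: (subsetP W1W).
have bWw : b \notin W :\ w by apply: contra bW; rewrite !inE => /andP[].
apply: labelled_leq (toggle (runcost #|W :\ w| t') (runcost #|W :\ w| t') _ _).
- rewrite -(leW w wW) t_gt0; case: (#|_ :\ w|) => [//|m].
  by rewrite runcostS leq_max mul2n -addnn addnAC leqnn orbT.
- apply: (@labelled_ext _ _ _ _ _ _ b (lit x w b)); rewrite ?in_set1 ?(negbTE bW1) //.
  have ok' : runnable S w (b |: [set w]) (W1 :\ b) (setv x b (lit x w b)) x.
    by apply: runnable_ext; rewrite ?in_set1 ?eqxx ?(negbTE bW1).
  apply: labelled_leq (IHlt _ _ _ _ _ _ wbT ok').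
  apply: runcost_mono; apply/subset_leq_card.
    by apply: subset_trans W1w; apply: subsetDl.
  by rewrite setD_shift; apply: setSD.
move=> w0 w0W rw ok2.
apply: (@labelled_ext _ _ _ _ _ _ b (lit (setv g w c) w b)); rewrite ?(negbTE bWw) //.
have ok' : runnable H v (b |: (w |: P)) (W :\ w :\ b)
    (setv (setv g w c) b (lit (setv g w c) w b)) (run w0 x).
  by apply: (runnable_ext ok2) => //; rewrite ?(negbTE bWw) // !inE eqxx.
apply: labelled_leq (IHlt _ _ _ _ _ _ wbP ok').
apply: runcost_mono; apply/subset_leq_card; first exact: subsetDl.
by rewrite !setD_shift; apply/setSD/subsetDl.
Qed.

(** Walking backwards along consistent arcs inside the finite set [D] would produce a consistent
    cycle. *)
Lemma no_con_inf g (D : {set V}) d : d \in D ->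
  (forall u, u \in D -> exists2 j, j \in D & con g j u) -> False.
Proof.
move=> dD h; have [s sD smin] := source_exists (con g) dD.
have [j jD cjs] := h s sD.
by apply: (NP cjs); apply: smin => //; apply: connect1.
Qed.

(** * Pockets and their roots *)

Definition free W := forall w, w \in W -> exists2 j, j \in W & A j w.

(* A pocket K is the part of W determined by its root o: as long as the lits
   entering W from outside are true, a value c of o propagates to kap k (+) c. *)
Definition pocket W o K (kap : V -> bool) :=
  [/\ [/\ o \in K, K \subset W & kap o = false],
      (forall k j, k \in K -> k != o -> j \in W -> A j k ->
         j \in K /\ lit kap j k = kap k),
      (forall j w, j \in K -> w \in W -> w \notin K -> A j w -> lit kap j w),
      free (W :\: K) &
      (forall k, k \in K -> connect (conP K kap) o k)].

Lemma exists_min (T : Type) (Q : T -> Prop) (m : T -> nat) t0 : Q t0 ->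
  exists2 t, Q t & forall t', Q t' -> m t <= m t'.
Proof.
move: {2}(m t0) (leqnn (m t0)) => k; elim: k t0 => [|k IH] t0 lt Qt.
  by exists t0 => // t' _; apply: leq_trans lt _.
case: (classic (exists2 t', Q t' & m t' < m t0)) => [[t' Qt' l]|n].
  by apply: (IH t') => //; rewrite -ltnS; apply: leq_trans lt.
exists t0 => // t' Qt'; rewrite leqNgt; apply/negP=> l; apply: n.
by exists t'.
Qed.

(* The minimum number of parts forbids merging a part into another one, which
   gives the last clauses of [pocket]; o is taken in a part that is last for
   reachability by consistent arcs. *)
Lemma pocket_exists W : W != set0 -> free W ->
  exists o K kap, pocket W o K kap /\
    ((forall j, j \in W -> A j o -> j \in K) \/ 1 < #|[set j in W | A j o]|).
Proof.
case/set0Pn=> w0 w0W Wfree.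
(* [p.1] sends a vertex to the root of its part, and [p.2] is its label relative to that root,
   normalized to 0 at the root. *)
pose good (p : {ffun V -> V} * {ffun V -> bool}) :=
  (forall w, w \in W -> [/\ p.1 w \in W, p.1 (p.1 w) = p.1 w & p.2 (p.1 w) = false]) /\
  (forall w j, w \in W -> p.1 w != w -> j \in W -> A j w ->
     p.1 j = p.1 w /\ lit p.2 j w = p.2 w).
pose roots (p : {ffun V -> V} * {ffun V -> bool}) := [set w in W | p.1 w == w].
have good0 : good ([ffun w => w], [ffun _ => false]).
  by split=> [w wW|w j _] /=; rewrite !ffunE ?eqxx.
have [[rho val] [/= p1 p2] pmin] := exists_min (fun p => #|roots p|) good0.
(* If the literals entering a root from [W] all have the value [b] and come from one other part, its
   part can be absorbed there with labels shifted by [b]. *)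
have merge w r b : w \in W -> rho w = w ->
    (forall j, j \in W -> A j w -> rho j = r /\ lit val j w = b) -> r = w.
  move=> wW rw h; apply/eqP; apply: contraT => nrw.
  have [j0 j0W a0] := Wfree _ wW.
  have [rj0 _] := h _ j0W a0; have [rW rr vr] := p1 _ j0W.
  rewrite rj0 in rW rr vr.
  pose rho' : {ffun V -> V} := [ffun u => if rho u == w then r else rho u].
  pose val' : {ffun V -> bool} := [ffun u => if rho u == w then val u (+) b else val u].
  have good' : good (rho', val').
    split=> [u uW|u j uW] /=.
      rewrite /rho' /val' !ffunE; case: (eqVneq (rho u) w) => ru.
        by rewrite rr (negbTE nrw).
      by have [h1 h2 h3] := p1 _ uW; rewrite h2 (negbTE ru).
    case: (eqVneq u w) => [->|uw].
      move=> _ jW a; have [rj lj] := h _ jW a.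
      rewrite /lit !ffunE rj (negbTE nrw) rw eqxx; split=> //.
      by have [_ _ ] := p1 _ wW; rewrite rw => ->.
    move=> ru jW a.
    have ru' : rho u != u.
      apply: contra ru => /eqP E; rewrite ffunE E.
      by rewrite (negbTE uw).
    have [e1 e2] := p2 _ _ uW ru' jW a.
    move: e2; rewrite /lit !ffunE e1; case: (rho u == w) => //.
    by case: (val j); case: (val u); case: b {h} val' ru; case: (sg j u).
  have : roots (rho', val') \proper roots (rho, val).
    apply/properP; split; last first.
      exists w; rewrite !inE ?wW /= ?rw ?eqxx // ffunE rw eqxx.
      by [].
    apply/subsetP=> u; rewrite !inE /= ffunE => /andP[->] /=.
    by case: (eqVneq (rho u) w) => // E /eqP E';
       move: E; rewrite -E' rr => E; rewrite E eqxx in nrw.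
  by move/proper_card; rewrite ltnNge pmin.
pose part r := [set k in W | rho k == r].
(* Otherwise a backward walk from [w] along consistent arcs of the part never meets the root, and so
   cycles. *)
have pconn r w : w \in part r -> connect (conP (part r) val) r w.
  move=> wp; apply: contraT => nc.
  pose D := [set u in part r | connect (conP (part r) val) u w].
  case: (@no_con_inf val D w); first by rewrite inE wp connect0.
  move=> u; rewrite inE => /andP[up cuw]; have := up; rewrite inE => /andP[uW /eqP ru].
  have [j jW a] := Wfree _ uW.
  have nu : rho u != u.
    apply/eqP => E; have Er : u = r by rewrite -E.
    by move: nc; rewrite -[X in ~~ connect _ X _]Er cuw.
  have [e1 e2] := p2 _ _ uW nu jW a.
  have cju : con val j u by rewrite /con a e2 eqxx.
  have jp : j \in part r by rewrite inE jW e1 ru eqxx.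
  exists j => //; rewrite inE jp.
  by apply: connect_trans cuw; apply: connect1; rewrite /conP /restr jp up.
have [r0W rr0 _] := p1 _ w0W.
have r0R : rho w0 \in roots (rho, val) by rewrite inE r0W /= rr0 eqxx.
(* The relation is reversed, so the source found is a root that is last for consistent arcs. *)
have [o oR omin] := source_exists [rel a b | con val b a] r0R.
have := oR; rewrite inE /= => /andP[oW /eqP ro].
have vo : val o = false by have [_ _] := p1 _ oW; rewrite ro.
have oK : o \in part o by rewrite inE oW ro eqxx.
(* A false literal leaving the part of [o] would be a consistent arc to the root of another part; as
   [o] is last, consistent arcs lead back and close a cycle. *)
have k2 j w : j \in part o -> w \in W -> w \notin part o -> A j w -> lit val j w.
  move=> jp wW wp a; have := jp; rewrite inE => /andP[jW /eqP rj].
  have wo : rho w != o by apply: contra wp; rewrite inE wW.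
  case: (eqVneq (rho w) w) => [rw|nw]; last first.
    by have [e _] := p2 _ _ wW nw jW a; rewrite -e rj eqxx in wo.
  apply: contraT => /negbTE l; have vw : val w = false by have [_ _] := p1 _ wW; rewrite rw.
  have cjw : con val j w by rewrite /con a l vw.
  have coj := conP_con (pconn _ _ jp).
  case: (NP cjw); apply: (connect_trans _ coj).
  have := omin w; rewrite !(connect_rev (con val)) /=; apply; last first.
    exact: connect_step coj cjw.
  by rewrite inE wW /= rw eqxx.
exists o, (part o), val; split; last first.
  case: (classic (forall j, j \in W -> A j o -> j \in part o)) => h; first by left.
  right; have [j0 h0] := not_all_ex_not _ _ h.
  have [j0W h1] := imply_to_and _ _ h0; have [a0 h2] := imply_to_and _ _ h1.
  rewrite ltnNge; apply/negP => c1; apply: h2; rewrite inE j0W /=.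
  apply/eqP; apply: (merge o (rho j0) (lit val j0 o)) => // j jW a.
  suff -> : j = j0 by [].
  by apply: (card_le1_eqP c1); rewrite inE ?jW ?j0W.
split=> //.
- by split=> //; apply/subsetP=> k; rewrite inE => /andP[].
- move=> k j; rewrite inE => /andP[kW /eqP rk] ko jW a.
  have [|e1 e2] := p2 _ _ kW _ jW a; first by rewrite rk eq_sym.
  by rewrite inE jW e1 rk eqxx.
- move=> w; rewrite inE => /andP[wp wW]; apply: NNPP => h.
  have allp j : j \in W -> A j w -> j \in part o.
    by move=> jW a; apply: contraT => jp; case: h; exists j; rewrite // inE jp.
  have wo : rho w != o by apply: contra wp; rewrite inE wW.
  case: (eqVneq (rho w) w) => [rw|nw].
    have E : o = w.
      apply: (merge w o true) => // j jW a; have jp := allp _ jW a.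
      by rewrite k2 //; move: jp; rewrite inE => /andP[_ /eqP].
    by rewrite -E ro eqxx in wo.
  have [j jW a] := Wfree _ wW; have [e _] := p2 _ _ wW nw jW a.
  by have := allp _ jW a; rewrite inE e (negbTE wo) andbF.
- by move=> k kp; apply: pconn.
Qed.

(** * Vertices with a unique line of ancestors, and pairs of states *)

Lemma F_eq x y i : (forall j, A j i -> x j = y j) -> F x i = F y i.
Proof.
move=> h; apply: eq_forallb => j; case a: (A j i) => //=.
by apply: litE; apply: h.
Qed.

Lemma run_sync (D : pred V) w x y :
  (forall i, i \in w -> D i -> forall j, A j i -> D j) ->
  (forall k, D k -> x k = y k) -> forall k, D k -> run w x k = run w y k.
Proof.
elim: w x y => [//|i w IH] x y h e k Dk /=; apply: IH => // [i' i'w|k' Dk'].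
  by apply: h; rewrite inE i'w orbT.
rewrite !upE; case: eqP => [E|_]; last exact: e.
by apply: F_eq => j a; apply/e/(h i) => //; rewrite -?E // mem_head.
Qed.

Definition ready W x := forall j w, j \notin W -> w \in W -> A j w -> lit x j w.

Lemma ready_run W w x : all (mem W) w -> ready W x -> ready W (run w x).
Proof.
move=> wW r j v jW vW a; rewrite (@litE _ x); first exact: r.
exact: run_out jW.
Qed.

Lemma ready_F W x w : ready W x -> w \in W ->
  (forall j, j \in W -> A j w -> lit x j w) -> F x w = true.
Proof.
move=> r wW h; apply: Ftrue => j a; case: (boolP (j \in W)) => jW; first exact: h.
exact: r.
Qed.

Definition indeg W u := #|[set j in W | A j u]|.
Definition iso W := [set w in W |
  [forall u, (u \in W) && connect (restr W A) u w ==> (indeg W u == 1)]].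

Lemma isoW W w : w \in iso W -> w \in W.
Proof. by rewrite inE => /andP[]. Qed.

Lemma iso_anc W u w : u \in W -> connect (restr W A) u w -> w \in iso W -> u \in iso W.
Proof.
move=> uW c; rewrite !inE uW => /andP[wW /forallP h]; apply/forallP=> a.
apply/implyP=> /andP[aW ca]; apply: (implyP (h a)).
by rewrite aW (connect_trans ca c).
Qed.

Lemma iso_arc W j w : j \in W -> A j w -> w \in iso W -> j \in iso W.
Proof.
move=> jW a wI; apply: iso_anc (wI) => //; apply: connect1.
by rewrite /restr jW a isoW.
Qed.

Lemma iso_parent W w : w \in iso W ->
  exists p, [/\ p \in W, A p w & forall j, j \in W -> A j w -> j = p].
Proof.
rewrite inE => /andP[wW /forallP/(_ w)]; rewrite wW connect0 /= => /cards1P[p E].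
have : p \in [set p] by rewrite inE.
rewrite -E inE => /andP[pW a]; exists p; split=> // j jW aj.
by apply/set1P; rewrite -E inE jW.
Qed.

(** In-neighbours of [iso W] lie in [iso W] or outside [W], where nothing is updated; so agreement
    persists. *)
Lemma iso_sync W w x y : all (mem W) w ->
  (forall k, k \notin W -> x k = y k) -> (forall k, k \in iso W -> x k = y k) ->
  forall k, k \in iso W -> run w x k = run w y k.
Proof.
move=> /allP wW e1 e2 k kI.
apply: (run_sync (D := [pred k | (k \notin W) || (k \in iso W)])) => //=.
- move=> i /wW iW; have -> /= : (i \notin W) = false by apply: negbF; exact: iW.
  move=> iI j a; case: (boolP (j \in W)) => //= jW; exact: iso_arc a iI.
- by move=> k' /orP[/e1|/e2].
by rewrite kI orbT.
Qed.

(** As [W1] is free, the only in-neighbour in [W] of such a vertex survives in [W1]. *)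
Lemma iso_sub W W1 : W1 \subset W -> free W1 -> iso W :&: W1 \subset iso W1.
Proof.
move=> sW fW1; apply/subsetP=> w; rewrite inE => /andP[wI wW1].
rewrite inE wW1; apply/forallP=> u; apply/implyP=> /andP[uW1 cuw].
have uI : u \in iso W.
  apply: iso_anc wI; first exact: (subsetP sW).
  by apply: connect_sub_rel cuw => a b /and3P[aW bW ab]; rewrite /restr !(subsetP sW).
have [p [pW ap up]] := iso_parent uI; have [j jW1 aj] := fW1 _ uW1.
apply/cards1P; exists p; apply/setP=> k; rewrite !inE; apply/andP/eqP.
  by case=> kW1 ak; apply: up => //; apply: (subsetP sW).
by move=> ->; rewrite -(up j) ?(subsetP sW).
Qed.

(* Updates of N that change nothing are dropped, and the word is stopped at the
   first one that does change something. *)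
Lemma trim (N : {set V}) (t : V -> bool) w x :
  (forall j, j \in N -> x j = t j) -> (exists2 j, j \in N & run w x j != t j) ->
  exists w0 e, [/\ e \in N, size w0 < size w, {subset rcons w0 e <= w},
    all [predC mem N] w0 & run (rcons w0 e) x e != t e].
Proof.
elim: w x => [|i w IH] x xt; first by case=> j jN; rewrite /= xt ?eqxx.
move=> /= nt; case: (boolP (i \in N)) => iN.
  case: (eqVneq (up x i i) (t i)) => e.
    have E : up x i = x.
      by apply/ffunP=> k; rewrite upE; case: eqP => // ->; rewrite xt // -e upE eqxx.
    rewrite E in nt; have [w0 [e' [h1 h2 h3 h4 h5]]] := IH _ xt nt.
    exists w0, e'; split=> //; first exact: leqW.
    by move=> k /h3; rewrite inE orbC => ->.
  by exists [::], i; split=> // k; rewrite /= !inE => /eqP->; rewrite eqxx.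
have xt' j : j \in N -> up x i j = t j.
  by move=> jN; rewrite upE; case: eqP => [E|_]; [rewrite -E jN in iN|apply: xt].
have [w0 [e' [h1 h2 h3 h4 h5]]] := IH _ xt' nt.
exists (i :: w0), e'; split=> //=; last by rewrite iN.
by move=> k; rewrite !inE => /orP[->//|/h3 ->]; rewrite orbT.
Qed.

(** Each vertex of the path is driven by its predecessor alone, so a flip of the first value travels
    along the consistent arcs to the last. *)
Lemma follow x (C : {set V}) p a (z : st) :
  (forall b, b \in C -> exists q, [/\ q \in C, forall j, j \in C -> A j b -> j = q &
     forall z : st, (forall k, k \notin C -> z k = x k) -> F z b = lit z q b]) ->
  path (conP C x) a p -> a \in C -> (forall k, k \notin C -> z k = x k) -> z a = ~~ x a ->
  run p z (last a p) = ~~ x (last a p).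
Proof.
move=> h; elim: p a z => [//|b p IH] a z /= /andP[/and3P[aC bC /andP[ab /eqP lab]] pp] _ zx za.
have [q [qC uq Fq]] := h _ bC.
apply: IH => // [k kC|].
  by rewrite upE; case: eqP => [E|_]; [rewrite E bC in kC|apply: zx].
rewrite upE eqxx Fq // -(uq a) // -lab /lit za.
by case: (x a); case: (sg a b).
Qed.

(** If all ancestors of [c] by consistent arcs were stable, each would have a consistent arc from
    its driving vertex, against [no_con_inf]. An unstable one is updated, and the change follows a
    simple path to [c]. *)
Lemma toggle_iso x (C : {set V}) c : c \in C ->
  (forall b, b \in C -> exists q, [/\ q \in C, A q b, forall j, j \in C -> A j b -> j = q &
     forall z : st, (forall k, k \notin C -> z k = x k) -> F z b = lit z q b]) ->
  exists w, [/\ all (mem C) (rcons w c), size w < #|C| & run (rcons w c) x c = ~~ x c].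
Proof.
move=> cC h.
pose D := [set a in C | connect (conP C x) a c].
have [a [aD ua]] : exists a, a \in D /\ F x a != x a.
  apply: NNPP => n; apply: (@no_con_inf x D c); first by rewrite inE cC connect0.
  move=> u; rewrite inE => /andP[uC cu]; have [q [qC aq _ Fq]] := h _ uC.
  have Fu : F x u = x u.
    by case: (eqVneq (F x u) (x u)) => // ne; case: n; exists u; rewrite inE uC cu.
  have cq : con x q u by rewrite /con aq -Fu (Fq x) // eqxx.
  exists q => //; rewrite inE qC; apply: connect_trans cu.
  by apply: connect1; rewrite /conP /restr qC uC.
move: aD; rewrite inE => /andP[aC /connectP[p pp lp]].
case/shortenP: pp lp => p' pp' up' _ lp.
have pC : all (mem C) (a :: p').
  rewrite /= aC; elim: p' a pp' {lp up' ua aC} => //= b p' IH a /andP[/and3P[_ -> _] /IH].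
  by [].
have E : rcons (belast a p') c = a :: p' by rewrite lastI -lp.
exists (belast a p'); rewrite E; split=> //.
  rewrite size_belast -[(size p').+1]/(size (a :: p')).
  by move/card_uniqP: up' => <-; apply/subset_leq_card/subsetP=> k /(allP pC).
rewrite lp /=; apply: (@follow x C) => //.
- by move=> b bC; have [q [? ? ? ?]] := h _ bC; exists q.
- by move=> k kC; rewrite upE; case: eqP => // ka; rewrite ka aC in kC.
by rewrite upE eqxx; move: ua; case: (F x a); case: (x a).
Qed.

(** On a path from an agreeing ancestor, some arc leads from agreement to disagreement. Its head has
    no other in-neighbour in [W], so one update makes it agree. *)
Lemma spread_iso W x y : (forall k, k \notin W -> x k = y k) ->
  (forall v, v \in iso W -> exists2 a, connect (restr W A) a v & x a = y a) ->
  exists w, [/\ all (mem W) w, size w <= #|[set v in iso W | x v != y v]| &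
    forall k, k \in iso W -> run w x k = run w y k].
Proof.
move: {2}#|_| (leqnn #|[set v in iso W | x v != y v]|) => m.
elim: m x y => [|m IH] x y le eW h.
  move: le; rewrite leqn0 cards_eq0 => /eqP E.
  exists [::]; split=> // k kI; apply/eqP; apply: contraT => ne /=.
  by have := in_set0 k; rewrite -E inE kI ne.
case: (set_0Vmem [set v in iso W | x v != y v]) => [E|[v]].
  exists [::]; split=> // k kI; apply/eqP; apply: contraT => ne /=.
  by have := in_set0 k; rewrite -E inE kI ne.
rewrite inE => /andP[vI nv]; have [a cav ea] := h v vI.
have [p [b [_ cbv /and3P[pW bW apb] /= /eqP ep nb]]] :=
  connect_cross (p := [pred k | x k == y k]) cav (introT eqP ea) nv.
have bI := iso_anc bW cbv vI.
have eb : F x b = F y b.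
  apply: F_eq => j aj; case: (boolP (j \in W)) => jW; last exact: eW.
  by have [q [_ _ uq]] := iso_parent bI; rewrite (uq _ jW aj) -(uq _ pW apb).
have le1 : #|[set v in iso W | up x b v != up y b v]| < #|[set v in iso W | x v != y v]|.
  apply/proper_card/properP; split; last first.
    by exists b; rewrite inE bI //= !upE eqxx eb eqxx.
  apply/subsetP=> k; rewrite !inE !upE => /andP[->] /=.
  by case: (eqVneq k b) => // ->; rewrite eb eqxx.
have [|k kW|k kI|w [wW sw ew]] := IH (up x b) (up y b).
- by rewrite -ltnS; apply: leq_trans le.
- by rewrite !upE; case: eqP => // _; apply: eW.
- have [c cck ec] := h k kI; exists c => //.
  by rewrite !upE; case: eqP.
by exists (b :: w); split=> //=; [rewrite bW|apply: leq_trans le1].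
Qed.

(** Invariant kept while [W] shrinks; for empty [W] the two states are equal. *)
Definition synced W x y :=
  [/\ free W, ready W x, ready W y, (forall k, k \notin W -> x k = y k) &
      (forall k, k \in iso W -> x k = y k)].

Lemma synced_run W w x y : all (mem W) w -> synced W x y -> synced W (run w x) (run w y).
Proof.
move=> wW [fW rx ry e1 e2]; split=> //; [exact: ready_run|exact: ready_run| |exact: iso_sync].
by move=> k kW; rewrite !(run_out _ wW kW); apply: e1.
Qed.

Lemma synced_sym W x y : synced W x y -> synced W y x.
Proof. by case=> fW rx ry e1 e2; split=> // k h; symmetry; first [exact: e1|exact: e2]. Qed.

(** * Reversing the literals of a root in a strongly connected graph *)

Hypothesis strong : forall u v, connect A u v.

Lemma root_run W o P g (z : st) : free W -> ready W z -> o \in P -> P \subset W ->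
  (forall p, p \in P -> g p = z p) -> (forall p, p \in P -> connect (conP P g) o p) ->
  exists w, [/\ all (mem (W :\: P)) w, size w <= runcost #|W|.-1 #|~: W| &
    forall j, j \in W -> A j o -> lit (run w z) j o = ~~ z o].
Proof.
move=> fW rz oP PW gz cP.
have ok : runnable setT o P (W :\: P) g z.
  split.
  - split; rewrite ?subsetT //; apply/pred0P=> k /=; rewrite !inE.
    by case: (k \in P).
  - by move=> h _; apply: connect_sub_rel (strong o h) => a b; rewrite /restr !inE.
  - exact: cP.
  - move=> d b a; rewrite !inE => /andP[bP bW]; rewrite negb_and negbK.
    by case: (boolP (d \in P)) => [dP _|_ /= dW]; [right; rewrite gz|left; apply: rz].
  - move=> b; rewrite !inE => /andP[bP bW]; have [d dW a] := fW _ bW.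
    exists d => //; rewrite !inE dW andbT.
    by case: (boolP (d \in P)) => dP; [right; rewrite gz|left].
have [w [g' [wW sw e1 c e2]]] := run_lemma (leqnn _) ok.
exists w; split=> //.
  apply: leq_trans sw _; apply: runcost_mono.
    have oW := subsetP PW _ oP.
    rewrite -ltnS prednK ?(cardsD1 o W) ?oW // add1n ltnS.
    by apply/subset_leq_card/subsetP=> k; rewrite !inE => /andP[kP ->]; rewrite andbT; apply: contraNneq kP => ->.
  apply/subset_leq_card/subsetP=> k; rewrite !inE.
  by case: (k \in P); case: (k \in W).
move=> j jW a; have -> : z o = g' o by rewrite e1 ?gz.
rewrite -(NP_lit a); last exact/conP_con/c.
apply: litE; case: (boolP (j \in P)) => jP.
  by rewrite e1 // gz // (run_out _ wW) // inE jP.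
by rewrite e2 // inE jP.
Qed.

Lemma connect_restr_l (S : {set V}) (e : rel V) a b :
  connect (restr S e) a b -> b \in S -> a \in S.
Proof. by case/connectP=> [[|c q]] /=; [move=> _ ->|case/andP=> /and3P[]]. Qed.

(** * Removing a pocket from the set of vertices still to be synchronized *)

Section Pocket.
Variables (W K : {set V}) (o : V) (kap : V -> bool).
Hypotheses (Wfree : free W) (pk : pocket W o K kap).

Let oK : o \in K. Proof. by case: pk => [[]]. Qed.
Let KW : K \subset W. Proof. by case: pk => [[]]. Qed.
Let kapo : kap o = false. Proof. by case: pk => [[]]. Qed.
Let Kin k j : k \in K -> k != o -> j \in W -> A j k -> j \in K /\ lit kap j k = kap k.
Proof. by case: pk => _ h _ _ _; apply: h. Qed.
Let Kout j w : j \in K -> w \in W -> w \notin K -> A j w -> lit kap j w.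
Proof. by case: pk => _ _ h _ _; apply: h. Qed.
Let W1free : free (W :\: K). Proof. by case: pk. Qed.
Let Kconn k : k \in K -> connect (conP K kap) o k.
Proof. by case: pk => _ _ _ _; apply. Qed.

(** The word lists the pocket in a topological order away from [o]; it exists since otherwise the
    remaining vertices would all have consistent in-neighbours among themselves. The order depends
    on [kap] only, not on the state. *)
Lemma spread_pocket : exists u, [/\ all (mem (K :\ o)) u, size u < #|K| &
  forall x, ready W x -> forall k, k \in K -> run u x k = kap k (+) x o].
Proof.
suff [u [uK su h]] : exists u, [/\ all (mem (K :\ o)) u, size u <= #|K :\: [set o]| &
  forall x, ready W x -> (forall k, k \in [set o] -> x k = kap k (+) x o) ->
  forall k, k \in K -> run u x k = kap k (+) x o].
  exists u; split=> //; first by rewrite (cardsD1 o K) oK ltnS.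
  by move=> x r; apply: h => // k; rewrite inE => /eqP->; rewrite kapo.
have: o \in [set o] by rewrite inE.
move: {2}#|_| (leqnn #|K :\: [set o]|) => m; elim: m [set o] => [|m IH] D.
  rewrite leqn0 cards_eq0 setD_eq0 => /subsetP KD _; exists [::]; split=> // x _ h k /KD; exact: h.
move=> le oD; case: (set_0Vmem (K :\: D)) => [|[k0 k0K]].
  move/eqP; rewrite setD_eq0 => /subsetP KD; exists [::]; split=> // x _ h k /KD; exact: h.
have [k kKD kin] : exists2 k, k \in K :\: D & forall j, j \in W -> A j k -> j \in D.
  apply: NNPP => n; apply: (@no_con_inf kap (K :\: D) k0) => // u uKD.
  have := uKD; rewrite inE => /andP[uD uK].
  have uo : u != o by apply: contraNneq uD => ->.
  apply: NNPP => n2; apply: n; exists u => // j jW a; apply: contraT => jD.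
  have [jK l] := Kin uK uo jW a.
  by case: n2; exists j; rewrite ?inE ?jD // /con a l eqxx.
have := kKD; rewrite inE => /andP[kD kK].
have ko : k != o by apply: contraNneq kD => ->.
have kW := subsetP KW _ kK.
have EK : K :\: D = k |: (K :\: (k |: D)).
  by apply/setP=> e; rewrite !inE; case: (eqVneq e k) => //= ->; rewrite kD kK.
have sz : #|K :\: D| = #|K :\: (k |: D)|.+1 by rewrite {1}EK cardsU1 !inE eqxx.
have [||u [uK su h]] := IH (k |: D); first by rewrite -ltnS -sz.
  by rewrite inE oD orbT.
exists (k :: u); split; [|by rewrite sz|].
  by apply/andP; split; [exact: kKD|apply: all_subset uK; apply/setDS/subsetUr].
move=> x r hD j jK /=.
have xo : up x k o = x o by rewrite upE eq_sym (negbTE ko).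
rewrite -[in RHS]xo; apply: h => //.
  have kw : all (mem W) [:: k] by rewrite /= kW.
  exact: (ready_run kw r).
have litk i : i \in W -> A i k -> lit x i k = kap k (+) x o.
  move=> iW a; have [iK l] := Kin kK ko iW a; rewrite -l /lit hD ?kin //.
  by case: (kap i); case: (x o); case: (sg i k).
move=> i; rewrite !inE xo upE; case: (eqVneq i k) => [-> _|_ /=]; last exact: hD.
case E: (kap k (+) x o); first by apply: (ready_F r) => // i' i'W a; rewrite litk.
by have [i' i'W a] := Wfree kW; apply: (Ffalse a); rewrite litk // E.
Qed.

Let W1 := W :\: K.
(** The vertices to which agreement cannot be spread from [Cs] or from [iso W]. *)
Let unsettled (Cs : {set V}) := [set v in iso W1 |
  [forall a, (a \in Cs :|: iso W) ==> ~~ connect (restr W1 A) a v]].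

Lemma unsettledPn (Cs : {set V}) v : v \in iso W1 -> v \notin unsettled Cs ->
  exists2 a, a \in Cs :|: iso W & connect (restr W1 A) a v.
Proof.
move=> vI; rewrite inE vI /= => /forallPn[a].
by rewrite negb_imply negbK => /andP[]; exists a.
Qed.

Lemma unsettledP (Cs : {set V}) v : v \in unsettled Cs ->
  v \in iso W1 /\ forall a, a \in Cs :|: iso W -> connect (restr W1 A) a v -> False.
Proof.
rewrite inE => /andP[vI /forallP h]; split=> // a aC c.
by have := h a; rewrite aC c.
Qed.

(* The components that become isolated once K is removed are given a vertex
   whose value is 0 in both states: it is forced to 0 in y by the pocket, and
   in x it can be flipped along its unique line of ancestors. *)
Lemma settle m Cs x y : #|unsettled Cs| <= m -> Cs \subset iso W1 ->
  ready W x -> ready W y ->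
  (forall k, k \in K -> x k = kap k (+) x o) -> (forall k, k \in K -> y k = ~~ kap k) ->
  (forall c, c \in Cs -> [/\ x c = false, y c = false & exists2 k, k \in K & A k c]) ->
  exists w (Cs' : {set V}), [/\ all (mem W1) w, size w <= 2 * #|unsettled Cs|,
    Cs' \subset iso W1, unsettled Cs' = set0 & forall c, c \in Cs' ->
      [/\ run w x c = false, run w y c = false & exists2 k, k \in K & A k c]].
Proof.
elim: m Cs x y => [|m IH] Cs x y le CsJ rx ry xK yK hCs.
  by exists [::], Cs; split=> //; apply/eqP; rewrite -cards_eq0 -leqn0.
case: (set_0Vmem (unsettled Cs)) => [E|[u0 u0U]]; first by exists [::], Cs; split.
pose R1 := restr W1 A; set U := unsettled Cs in le u0U *.
have W1P v : v \in W1 -> v \in W /\ v \notin K by rewrite inE => /andP[].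
have UW1 v : v \in U -> v \in W1 by case/unsettledP=> /isoW.
have Uanc a v : a \in W1 -> connect R1 a v -> v \in U -> a \in U.
  move=> aW1 cav /unsettledP[vI nv]; apply: contraT => aU.
  have [b bC cba] := unsettledPn (iso_anc aW1 cav vI) aU.
  by case: (nv b bC); apply: connect_trans cav.
pose D0 := [set c in U | [exists k in K, A k c]].
(* If no ancestor of [u] had an in-neighbour in the pocket, removing the pocket would not change
   their in-degrees, and [u] would already be in [iso W]. *)
have D0P u : u \in U -> exists2 c, c \in D0 & connect R1 c u.
  move=> uU; apply: NNPP => n.
  pose S := [set a in W1 | connect R1 a u].
  have SK a b : b \in S -> A a b -> a \notin K.
    rewrite inE => /andP[bW1 cbu] ab; apply/negP=> aK; apply: n; exists b => //.
    by rewrite inE (Uanc b u) //; apply/exists_inP; exists a.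
  have Scl a b : a \in W -> b \in S -> A a b -> a \in S.
    move=> aW bS ab; have aW1 : a \in W1 by rewrite inE aW (SK a b).
    have := bS; rewrite !inE => /andP[/andP[bK bW] cbu].
    rewrite -in_setD -/W1 aW1; apply: connect_trans cbu; apply: connect1.
    by rewrite /R1 /restr aW1 ab inE bK bW.
  have uS : u \in S by rewrite inE UW1 ?connect0.
  have [uI nu] := unsettledP uU; apply: (nu u); last exact: connect0.
  have [uW _] := W1P _ (UW1 _ uU).
  rewrite inE; apply/orP; right; rewrite inE uW /=; apply/forallP=> a.
  apply/implyP=> /andP[aW cau].
  have aS : a \in S by apply: (connect_restr_l (restr_closed Scl cau uS) uS).
  have aI : a \in iso W1 by move: aS; rewrite inE => /andP[aW1 c]; apply: iso_anc c uI.
  move: aI; rewrite inE => /andP[aW1 /forallP/(_ a)]; rewrite aW1 connect0 /=.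
  congr (_ == _); rewrite /indeg; apply: eq_card => j; rewrite !inE.
  by case aj: (A j a); rewrite ?andbF // (SK j a).
have [c0 c0D _] := D0P _ u0U.
(* Taking a source of [D0] ensures that [c] reaches all of its ancestors, so the whole of [C] is
   settled together with [c]. *)
have [c cD cmin] := source_exists R1 c0D.
have := cD; rewrite inE => /andP[cU /exists_inP[k kK akc]].
pose C := [set a in W1 | connect R1 a c].
have cW1 := UW1 _ cU; have [cW cK] := W1P _ cW1.
have cC : c \in C by rewrite inE cW1 connect0.
have CU : C \subset U.
  by apply/subsetP=> a; rewrite inE => /andP[aW1 cac]; apply: Uanc cac cU.
have CW1 a : a \in C -> a \in W1 by rewrite inE => /andP[].
have CK a : a \in K -> a \notin C.
  by move=> aK; apply/negP => /CW1/W1P[_]; rewrite aK.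
have CI a : a \in C -> a \in iso W1.
  by move/(subsetP CU)/unsettledP=> [].
have cI := CI _ cC.
have Fy0 (z : st) : (forall k, k \in K -> z k = ~~ kap k) -> F z c = false.
  move=> zK; apply: (Ffalse akc).
  rewrite /lit zK //; have := Kout kK cW cK akc; rewrite /lit.
  by case: (kap k); case: (sg k c).
have [w0 [w0C sw0 xc yc]] : exists w0, [/\ all (mem C) w0, size w0 <= 2 * #|C|,
    run w0 x c = false & run w0 y c = false].
  have C_gt0 : 0 < #|C| by apply/card_gt0P; exists c.
  have cc : all (mem C) [:: c] by rewrite /= cC.
  case E: (F x c); last first.
    exists [:: c]; split=> //=; first by rewrite mul2n -addnn addn_gt0 C_gt0.
      by rewrite upE eqxx.
    by rewrite upE eqxx Fy0.
  (* Otherwise the pocket has the values [~~ kap] in [x] too, and forces [c] to 0. *)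
  have xo : x o = false.
    apply/negbTE/negP => xo; move: E; rewrite Fy0 // => k' k'K.
    by rewrite xK // xo addbT.
  (* In [x], [c] is first set to 1 and then flipped through its ancestors; in [y] the pocket makes
     the last letter give 0 in any case. *)
  have [|w1 [w1C sw1 rc]] := @toggle_iso (up x c) C c cC.
    move=> b bC; have [p [pW1 apb up]] := iso_parent (CI _ bC).
    have pC : p \in C.
      rewrite inE pW1; have := bC; rewrite inE => /andP[bW1]; apply: connect_trans.
      by apply: connect1; rewrite /R1 /restr pW1 bW1.
    exists p; split=> // [j /CW1|z zx]; first exact: up.
    have [bW bK] := W1P _ (CW1 _ bC).
    case l: (lit z p b); last by apply: (Ffalse apb); rewrite l.
    apply: Ftrue => j a; case: (boolP (j \in W1)) => jW1; first by rewrite (up j).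
    have jC : j \notin C by apply: contra jW1 => /CW1.
    have jc : j != c by apply: contraNneq jC => ->.
    have zj : z j = x j by rewrite zx // upE (negbTE jc).
    case: (boolP (j \in K)) => jK.
      by rewrite (@litE _ kap) ?Kout // zj xK // xo addbF.
    rewrite (litE _ zj); apply: rx => //; apply: contra jW1 => jW.
    by rewrite inE jK.
  exists (c :: rcons w1 c); split=> /=.
  - by rewrite cC.
  - by rewrite size_rcons mul2n -addnn -[_.+2]addn1 leq_add.
  - by rewrite rc upE eqxx E.
  rewrite run_rcons upE eqxx Fy0 // => k' k'K.
  have w1C' : all (mem C) w1 by move: w1C; rewrite all_rcons => /andP[].
  rewrite (run_out _ w1C') ?CK // upE; case: eqP => [E'|_]; last exact: yK.
  by rewrite -E' k'K in cK.
have w0W1 : all (mem W1) w0 by apply/allP=> a /(allP w0C) /CW1.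
have w0W : all (mem W) w0 by apply: all_subset w0W1; apply: subsetDl.
have CsC a : a \in Cs -> a \notin C.
  move=> aCs; apply/negP=> /(subsetP CU)/unsettledP[_ /(_ a)]; apply.
    by rewrite inE aCs.
  exact: connect0.
have disj : [disjoint unsettled (c |: Cs) & C].
  apply/pred0P=> a /=; apply/negP=> /andP[/unsettledP[aI na] aC].
  have [d dD cda] := D0P _ (subsetP CU _ aC).
  have := aC; rewrite inE => /andP[_ cac].
  have dc := connect_trans cda cac.
  have cd := cmin d dD dc.
  by apply: (na c); [rewrite !inE eqxx|apply: connect_trans cd cda].
have sub : unsettled (c |: Cs) :|: C \subset U.
  rewrite subUset CU andbT; apply/subsetP=> a /unsettledP[aI na].
  rewrite inE aI; apply/forallP=> b; apply/implyP=> bC; apply/negP=> cba.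
  by apply: (na b) => //; move: bC; rewrite !inE => /orP[->|->]; rewrite ?orbT.
have szU : #|unsettled (c |: Cs)| + #|C| <= #|U|.
  have := subset_leq_card sub; rewrite cardsU.
  by move: disj; rewrite -setI_eq0 => /eqP->; rewrite cards0 subn0.
have C_gt0 : 0 < #|C| by apply/card_gt0P; exists c.
have [||||k' k'K|k' k'K|c'|w [Cs' [wW1 sw CsJ' U0 h]]] :=
    IH (c |: Cs) (run w0 x) (run w0 y).
- by rewrite -ltnS; apply: leq_trans le; apply: leq_trans szU; rewrite -addn1 leq_add2l.
- by rewrite subUset sub1set cI.
- exact: ready_run.
- exact: ready_run.
- by rewrite !(run_out _ w0C) ?CK // xK.
- by rewrite !(run_out _ w0C) ?CK // yK.
- rewrite !inE => /orP[/eqP->|c'C]; first by split=> //; exists k.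
  by rewrite !(run_out _ w0C) ?CsC //; apply: hCs.
exists (w0 ++ w), Cs'; split=> //.
- by rewrite all_cat w0W1.
- rewrite size_cat; apply: leq_trans (leq_add sw0 sw) _.
  by rewrite -mulnDr leq_mul2l /= addnC.
by move=> c' /h; rewrite !run_cat.
Qed.

Let newiso := #|iso W1 :\: iso W|.

Lemma unsettled0 : #|unsettled set0| <= newiso.
Proof.
apply/subset_leq_card/subsetP=> v /unsettledP[vI nv]; rewrite inE vI andbT.
by apply/negP=> vW; apply: (nv v); [rewrite !in_setU vW orbT|apply: connect0].
Qed.

(** With [o] at 0 the pocket takes the values [kap], for which all literals leaving it are true; so
    [W1] becomes ready. Agreement on [iso W1] is then spread from [Cs] and [iso W]. *)
Lemma synced_pocket Cs x y : synced W x y -> x o = false -> y o = false ->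
  Cs \subset iso W1 -> unsettled Cs = set0 -> (forall c, c \in Cs -> x c = y c) ->
  exists w, [/\ all (mem W) w, size w < #|K| + newiso & synced W1 (run w x) (run w y)].
Proof.
move=> sxy xo yo CsJ U0 hCs; have [u [uK su hu]] := spread_pocket.
have uK' : all (mem K) u by apply: all_subset uK; apply: subsetDl.
have uW : all (mem W) u by apply: all_subset uK'.
have [_ rx ry e1 e2] := synced_run uW sxy.
have [_ rx0 ry0 _ _] := sxy.
have xK k : k \in K -> run u x k = kap k by move/(hu _ rx0) => ->; rewrite xo addbF.
have yK k : k \in K -> run u y k = kap k by move/(hu _ ry0) => ->; rewrite yo addbF.
have out k : k \notin W1 -> run u x k = run u y k.
  rewrite inE negb_and negbK => /orP[kK|]; [by rewrite xK // yK|exact: e1].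
have W1W : W1 \subset W by apply: subsetDl.
have [v vI|w [wW1 sw ew]] := @spread_iso W1 _ _ out.
  have [|a aC c] := @unsettledPn Cs v vI; first by rewrite U0 inE.
  exists a => //; move: aC; rewrite in_setU => /orP[aC|]; last exact: e2.
  have aK : a \notin K by have := isoW (subsetP CsJ _ aC); rewrite inE => /andP[].
  by rewrite !(run_out _ uK' aK) hCs.
have wW : all (mem W) w by apply: all_subset wW1.
exists (u ++ w); rewrite !run_cat; split; first by rewrite all_cat uW.
  rewrite size_cat -addSn leq_add //; apply: leq_trans sw _.
  apply/subset_leq_card/subsetP=> v; rewrite inE => /andP[vI ne].
  rewrite inE vI andbT; apply: contra ne => vW; apply/eqP; exact: e2.
have rdy (z : st) : ready W z -> (forall k, k \in K -> z k = kap k) -> ready W1 (run w z).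
  move=> rz zK j v jW1; rewrite inE => /andP[vK vW] a.
  rewrite (@litE _ z) ?(run_out _ wW1) //.
  case: (boolP (j \in K)) => jK; first by rewrite (@litE _ kap) ?zK // Kout.
  by apply: rz => //; apply: contra jW1 => jW; rewrite inE jK.
split=> //; [exact: rdy|exact: rdy|].
by move=> k kW1; rewrite !(run_out _ wW1 kW1) out.
Qed.

Definition steppable x y N :=
  exists w, [/\ all (mem W) w, size w <= N & synced W1 (run w x) (run w y)].

Lemma steppable_run w x y N N' : all (mem W) w ->
  steppable (run w x) (run w y) N -> size w + N <= N' -> steppable x y N'.
Proof.
move=> wW [w' [w'W sw' s]] le; exists (w ++ w'); rewrite !run_cat; split=> //.
  by rewrite all_cat wW.
by rewrite size_cat; apply: leq_trans le; rewrite leq_add2l.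
Qed.

Lemma steppable_sym x y N : steppable x y N -> steppable y x N.
Proof. by case=> w [wW sw s]; exists w; split=> //; apply: synced_sym. Qed.

Let cost := runcost #|W|.-1 #|~: W|.
Let oW : o \in W. Proof. exact: (subsetP KW). Qed.

Lemma letter_o : all (mem W) [:: o].
Proof. by rewrite /= oW. Qed.

(** Complementing [kap] keeps consistent arcs of the pocket consistent, and the zeros of [Cs] are
    attached to it by false literals. So [K] and [Cs] count as explored and are not updated. *)
Lemma pocket_root_run Cs (z : st) : ready W z -> z o = true ->
  (forall k, k \in K -> z k = ~~ kap k) -> Cs \subset W1 ->
  (forall c, c \in Cs -> z c = false /\ exists2 k, k \in K & A k c) ->
  exists w, [/\ all (mem (W :\: (K :|: Cs))) w, size w <= cost &
    forall j, j \in W -> A j o -> ~~ lit (run w z) j o].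
Proof.
move=> rz zo zK CsW1 hCs; pose g k := (k \in K) && ~~ kap k.
have CsK c : c \in Cs -> (c \notin K) && (c \in W).
  by move/(subsetP CsW1); rewrite inE.
have gz p : p \in K :|: Cs -> g p = z p.
  rewrite in_setU => /orP[pK|pC]; first by rewrite /g pK zK.
  by have /andP[pK _] := CsK _ pC; have [-> _] := hCs _ pC; rewrite /g (negbTE pK).
have cK k : k \in K -> connect (conP (K :|: Cs) g) o k.
  move=> kK; apply: connect_sub_rel (Kconn kK) => a b /and3P[aK bK /andP[ab l]].
  rewrite /conP /restr !in_setU aK bK /= /con ab /=; move: l.
  rewrite /lit /g aK bK.
  by case: (kap a); case: (kap b); case: (sg a b).
have [|||p|w [wW sw h]] := @root_run W o (K :|: Cs) g z Wfree rz.
- by rewrite in_setU oK.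
- by rewrite subUset KW; apply/subsetP=> c /CsK/andP[].
- exact: gz.
- rewrite in_setU => /orP[|pC]; first exact: cK.
  have [pz [k kK akp]] := hCs _ pC; have /andP[pK pW] := CsK _ pC.
  apply: connect_step (cK _ kK) _.
  rewrite /conP /restr !in_setU kK pC orbT /= /con akp /=.
  have := Kout kK pW pK akp; rewrite /lit /g kK (negbTE pK) /=.
  by case: (kap k); case: (sg k p).
exists w; split=> // j jW a; by rewrite h // zo.
Qed.

Lemma raise_root x : ready W x -> x o = false ->
  exists w, [/\ all (mem W) w, size w <= cost.+1 & run w x o = true].
Proof.
move=> rx xo; have [||p|p|w [wW sw h]] := @root_run W o [set o] x x Wfree rx.
- by rewrite inE.
- by rewrite sub1set.
- by [].
- by rewrite inE => /eqP->; apply: connect0.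
have wW' : all (mem W) w by apply: all_subset wW; apply: subsetDl.
exists (rcons w o); split; rewrite ?size_rcons //.
  by rewrite all_rcons /= oW.
rewrite run_rcons upE eqxx; apply: (ready_F (W := W)) => //; first exact: ready_run.
by move=> j jW a; rewrite h // xo.
Qed.

(** Once all literals entering [o] are false in [y], one must become false in [x] while another
    stays false in [y]. With a loop at [o], updating [o] does it; without one, a second run,
    trimmed, does. *)
Lemma step_out_raised x y : 1 < indeg W o -> synced W x y -> y o = true ->
  steppable x y ((if A o o then 1 else 2) * cost + (3 * #|K| + 3 * newiso)).-1.
Proof.
move=> deg2 sxy yo; have [u [uK su hu]] := spread_pocket.
have uK' : all (mem K) u by apply: all_subset uK; apply: subsetDl.
have uW : all (mem W) u by apply: all_subset uK'.
have uo z : run u z o = z o by apply: run_out uK _; rewrite !inE eqxx.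
have [_ rx ry _ _] := sxy; have s1 := synced_run uW sxy.
have [_ rx1 ry1 _ _] := s1.
(* The zeros placed on [Cs] now are not touched again before [o] is set to 0 in both states. *)
have [|k kK|k kK|c|w3 [Cs [w3W1 sw3 CsJ U0 hCs]]] :=
    @settle _ set0 (run u x) (run u y) (leqnn _) _ rx1 ry1.
- exact: sub0set.
- by rewrite hu // uo.
- by rewrite hu // yo addbT.
- by rewrite inE.
have W1W : W1 \subset W by apply: subsetDl.
have w3W : all (mem W) w3 by apply: all_subset w3W1.
have s2 := synced_run w3W s1; set x2 := run w3 _ in s2 hCs *; set y2 := run w3 _ in s2 hCs *.
have KW1 k : k \in K -> k \notin W1 by rewrite inE => ->.
have xK k : k \in K -> x2 k = kap k (+) x o.
  by move=> kK; rewrite (run_out _ w3W1) ?KW1 // hu.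
have yK k : k \in K -> y2 k = ~~ kap k.
  by move=> kK; rewrite (run_out _ w3W1) ?KW1 // hu // yo addbT.
have xo2 : x2 o = x o by rewrite xK // kapo.
have yo2 : y2 o = true by rewrite yK // kapo.
have CsW1 : Cs \subset W1 by apply/subsetP=> c /(subsetP CsJ)/isoW.
have [_ rx2 ry2 _ _] := s2.
have [|w4 [w4W sw4 lit4]] := pocket_root_run ry2 yo2 yK CsW1.
  by move=> c /hCs[].
have w4W' : all (mem W) w4 by apply: all_subset w4W; apply: subsetDl.
have s3 := synced_run w4W' s2; set x3 := run w4 _ in s3; set y3 := run w4 _ in s3 lit4.
have PW4 (z : st) p : p \in K :|: Cs -> run w4 z p = z p.
  by move=> pP; rewrite (run_out _ w4W) // inE pP.
have xo3 : x3 o = x o by rewrite /x3 PW4 ?xo2 // in_setU oK.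
have yo3 : y3 o = true by rewrite /y3 PW4 ?yo2 // in_setU oK.
have C3 c : c \in Cs -> x3 c = false /\ y3 c = false.
  by move=> cC; rewrite /x3 /y3 !PW4 ?in_setU ?cC ?orbT //; have [-> ->] := hCs _ cC.
have cW1 c : c \in Cs -> (c \notin K) && (c \in W) by move/(subsetP CsW1); rewrite inE.
have Co c : c \in Cs -> c != o by move/cW1/andP=> [cK _]; apply: contraNneq cK => ->.
have [e1 [e2 [e1W ae1 e2W ae2 ne]]] : exists e1 e2,
    [/\ e1 \in W, A e1 o, e2 \in W, A e2 o & e1 != e2].
  have := deg2; rewrite /indeg => /card_gt1P[a [b [aN bN ne]]]; exists a, b.
  by move: aN bN; rewrite !inE => /andP[-> ->] /andP[-> ->].
have other e : exists e', [/\ e' \in W, A e' o & e' != e].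
  by case: (eqVneq e1 e) => [<-|n]; [exists e2; rewrite eq_sym|exists e1].
have lower (z z' : st) N : synced W z z' ->
    (exists j, [/\ j \in W, A j o & ~~ lit z j o]) ->
    (exists j, [/\ j \in W, A j o & ~~ lit z' j o]) ->
    (forall c, c \in Cs -> z c = z' c) -> #|K| + newiso <= N -> steppable z z' N.
  move=> sz [j [jW aj lj]] [j' [j'W aj' lj']] eC le.
  have sz' := synced_run letter_o sz.
  have [|||w [wW sw h]] := synced_pocket sz' _ _ CsJ U0.
  - by rewrite /= upE eqxx (Ffalse aj).
  - by rewrite /= upE eqxx (Ffalse aj').
  - by move=> c cC; rewrite /= !upE (negbTE (Co _ cC)) eC.
  apply: (steppable_run letter_o (N := (#|K| + newiso).-1)).
    by exists w; split=> //; rewrite -ltnS (leq_trans sw) // leqSpred.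
  by rewrite add1n; apply: leq_trans le; rewrite prednK // (cardsD1 o) oK.
have K_gt0 : 0 < #|K| by rewrite (cardsD1 o) oK.
have su3 : size w3 <= 2 * newiso by apply: leq_trans sw3 _; rewrite leq_mul2l unsettled0.
pose pre := u ++ w3 ++ w4.
have preW : all (mem W) pre by rewrite !all_cat uW w3W w4W'.
have prex : run pre x = x3 by rewrite !run_cat.
have prey : run pre y = y3 by rewrite !run_cat.
have szpre : size pre < #|K| + 2 * newiso + cost.
  by rewrite !size_cat addnA -addSn leq_add // -addSn leq_add.
case: (boolP [exists j in W, A j o && ~~ lit x3 j o]) => [/exists_inP[j jW /andP[a l]]|].
  apply: (steppable_run preW (N := #|K| + newiso)).
    rewrite prex prey; apply: lower => //.
    - by exists j.
    - by exists e1; rewrite lit4.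
    - by move=> c /C3[-> ->].
  case: (A o o); move: szpre K_gt0; move: (size pre) (#|K|) (newiso) (cost);
    by clear=> *; lia.
move=> nL; have Lx j : j \in W -> A j o -> lit x3 j o.
  move=> jW a; apply: contraNT nL => l; apply/exists_inP; exists j => //.
  by rewrite a.
have Fx3 : F x3 o = true by case: s3 => _ r _ _ _; apply: (ready_F r oW).
have Fy3 : F y3 o = false by apply: (Ffalse ae1); apply: lit4.
have s4 := synced_run letter_o s3.
have [_ rx3 _ _ _] := s3.
case: (boolP (A o o)) => [aoo|noo].
  (* The loop literal is true in [x3] and false in [y3]. After one update of [o] it is false in the
     first state, and another literal is still false in the second. *)
  have xo : x3 o = false.
    have := Lx o oW aoo; have := lit4 o oW aoo; rewrite /lit yo3.
    by case: (x3 o) => // /negbTE->.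
  apply: (steppable_run preW (N := (#|K| + newiso).+1)); last first.
    move=> /=; move: szpre K_gt0; move: (size pre) (#|K|) (newiso) (cost).
    by clear=> *; lia.
  rewrite prex prey; apply: (steppable_run letter_o (N := #|K| + newiso)) => //.
  apply: lower => //.
  - exists o; split=> //=; have := Lx o oW aoo; rewrite /lit xo upE eqxx Fx3.
    by case: (sg o o).
  - have [e [eW ae neo]] := other o; exists e; split=> //=.
    by rewrite (@litE _ y3) ?lit4 // upE (negbTE neo).
  - by move=> c cC; rewrite /= !upE (negbTE (Co _ cC)); have [-> ->] := C3 _ cC.
(* Raising [o] in the first state prepares the second run; without a loop it leaves the literals
   entering [o] unchanged. *)
have [w5 [w5o sw5 xo5 x5K]] : exists w5, [/\ {subset w5 <= [:: o]}, size w5 <= 1,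
    run w5 x3 o = true & run u (run w5 x3) =1 run u (run w5 x3)].
  case E: (x o); first by exists [::]; split=> //; rewrite /= xo3.
  by exists [:: o]; split=> //; rewrite /= upE eqxx.
have w5W : all (mem W) w5 by apply/allP=> k /w5o; rewrite inE => /eqP->.
have out5 (z : st) k : k != o -> run w5 z k = z k.
  by move=> ko; apply: run_notin; apply: contra ko => /w5o; rewrite inE.
have s5 := synced_run w5W s3; set x5 := run w5 _ in s5 xo5 x5K.
set y5 := run w5 _ in s5; clear x5K.
have [_ rx5 _ _ _] := s5; have s6 := synced_run uW s5; have [_ rx6 _ _ _] := s6.
have No j : A j o -> j != o by move=> a; apply/eqP=> E; move: a; rewrite E (negbTE noo).
have CsNK c : c \in Cs -> c \notin K by move/cW1/andP=> [].
have [|k kK||c cC|w6 [w6W sw6 lit6]] := @pocket_root_run Cs (run u x5) rx6.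
- by rewrite uo.
- by rewrite hu // xo5 addbT.
- exact: CsW1.
- rewrite (run_out _ uK') ?CsNK // out5 ?Co //; have [-> _] := C3 _ cC.
  by split=> //; have [] := hCs _ cC.
(* The run stops when the first literal, that of [e], turns false in the first state; the other
   in-neighbours have not been updated, so their literals are still false in the second. *)
have [j||] := @trim [set j in W | A j o] (fun j => sg j o) (u ++ w6) x5.
- by rewrite inE => /andP[jW a]; have := Lx j jW a; rewrite /lit out5 ?No // => /eqP.
- exists e1; first by rewrite inE e1W.
  by rewrite run_cat; apply: lit6.
move=> w0 [e [eN sw0 sub0 notN le]]; have := eN; rewrite inE => /andP[eW ae].
have w0W : all (mem W) (rcons w0 e).
  apply/allP=> k /sub0; rewrite mem_cat => /orP[/(allP uW)//|/(allP w6W) h].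
  by have : k \in W :\: (K :|: Cs) := h; rewrite in_setD => /andP[].
have s7 := synced_run w0W s5.
have CsN c (z : st) : c \in Cs -> run (rcons w0 e) z c = z c.
  move=> cC; apply: run_notin; apply/negP=> /sub0; rewrite mem_cat => /orP[/(allP uK') cK|/(allP w6W) h].
    by have := CsNK _ cC; rewrite (_ : c \in K).
  by have : c \in W :\: (K :|: Cs) := h; rewrite in_setD in_setU cC orbT.
apply: (steppable_run preW (N := 1 + (#|K|.-1 + cost) + (#|K| + newiso))); last first.
  move=> /=; move: szpre K_gt0; move: (size pre) (#|K|) (newiso) (cost).
  by clear=> *; lia.
rewrite prex prey; apply: (steppable_run w5W (N := (#|K|.-1 + cost) + (#|K| + newiso))).
  apply: (steppable_run w0W (N := #|K| + newiso)).
    apply: lower => //.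
    - by exists e; split.
    - have [e' [e'W ae' ne']] := other e; exists e'; split=> //.
      rewrite (@litE _ y3) ?lit4 // run_notin; first by rewrite out5 // No.
      rewrite mem_rcons inE negb_or ne'; apply/negP=> /(allP notN) /=.
      by rewrite inE e'W ae'.
    - by move=> c cC; rewrite !CsN // !out5 ?Co //; have [-> ->] := C3 _ cC.
  rewrite leq_add2r size_rcons; apply: leq_trans sw0 _.
  by rewrite size_cat leq_add // -ltnS prednK.
move: sw5 K_gt0; move: (size w5) (#|K|) (newiso) (cost).
by clear=> *; lia.
Qed.

(** If [o] is 0 in both states, one more run raises it in one of them. *)
Lemma step_out x y : 1 < indeg W o -> synced W x y ->
  steppable x y ((if A o o then 2 else 3) * cost + 3 * #|K| + 3 * newiso).
Proof.
move=> deg sxy.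
have K_gt0 : 0 < #|K| by rewrite (cardsD1 o) oK.
set R := (_ + _ in X in steppable _ _ X).
have done (z z' : st) N : synced W z z' -> z o || z' o ->
    ((if A o o then 1 else 2) * cost + (3 * #|K| + 3 * newiso)).-1 <= N -> steppable z z' N.
  move=> sz zo le.
  suff [w [wW sw h]] : steppable z z' ((if A o o then 1 else 2) * cost + (3 * #|K| + 3 * newiso)).-1.
    by exists w; split=> //; apply: leq_trans le.
  case/orP: zo => zo; last exact: step_out_raised.
  by apply/steppable_sym/step_out_raised => //; apply: synced_sym.
case: (boolP (x o || y o)) => xyo.
  by apply: done => //; apply: leq_trans (leq_pred _) _; rewrite addnA !leq_add2r leq_mul2r; case: (A o o); rewrite orbT.
move: xyo; rewrite negb_or => /andP[/negbTE xo _]; have [_ rx _ _ _] := sxy.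
have [w [wW sw rw]] := raise_root rx xo.
apply: (steppable_run wW (done _ _ _ (synced_run wW sxy) _ (leqnn _))); first by rewrite rw.
rewrite /R; move: sw; case: (A o o); move: (size w) (#|K|) (newiso) (cost) K_gt0;
  by clear=> *; lia.
Qed.

Let full (z : st) := forall k, k \in K -> z k = kap k (+) z o.

(** * Pockets that contain all in-neighbours in [W] of their root *)

Section ClosedPocket.
Hypothesis Kclosed : forall j, j \in W -> A j o -> j \in K.

Let Kpred k j : k \in K -> j \in W -> A j k -> j \in K.
Proof.
move=> kK jW a; case: (eqVneq k o) a => [->|ko] a; first exact: Kclosed.
by have [] := Kin kK ko jW a.
Qed.

Lemma closed_lit_root j : j \in W -> A j o -> lit kap j o.
Proof.
move=> jW a; rewrite NP_lit ?kapo //.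
by apply/conP_con/Kconn/Kclosed.
Qed.

(** The disjunction accounts for the root: literals entering it are true for [kap], although [kap o]
    is 0. *)
Lemma full_lit (z : st) v j : full z -> v \in K -> j \in W -> A j v ->
  lit z j v = ((v == o) || kap v) (+) z o.
Proof.
move=> fz vK jW a; have jK := Kpred vK jW a.
have : lit kap j v = (v == o) || kap v.
  case: (eqVneq v o) a => [->|vo] a /=; first exact: closed_lit_root.
  by have [] := Kin vK vo jW a.
rewrite /lit fz // => <-.
by case: (kap j); case: (z o); case: (sg j v).
Qed.

Lemma full_flip (z : st) : ready W z -> full z -> F z o = ~~ z o.
Proof.
move=> rz fz; have l j : j \in W -> A j o -> lit z j o = ~~ z o.
  by move=> jW a; rewrite full_lit // eqxx.
case E: (z o); last by apply: (ready_F rz) => // j jW a; rewrite l // E.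
by have [j jW a] := Wfree oW; apply: (Ffalse a); rewrite l // E.
Qed.

(** All literals entering [v] are true in [z] and false in [z']. Flipping [o] and spreading would
    falsify them in [z]; trimmed at the first one falsified, the word leaves another false in [z'],
    so updating [v] gives 0 in both. *)
Lemma merge_at (z z' : st) v : ready W z -> full z -> full z' -> z' o = ~~ z o ->
  v \in K -> indeg W v != 1 -> (v == o) || kap v = ~~ z o ->
  exists w, [/\ all (mem W) w, size w <= #|K|.+1 & run w z v = run w z' v].
Proof.
move=> rz fz fz' zz' vK deg lv; have [u [uK su hu]] := spread_pocket.
have uK' : all (mem K) u by apply: all_subset uK; apply: subsetDl.
have uW : all (mem W) u by apply: all_subset uK'.
have vW := subsetP KW _ vK.
have [j0 j0W a0] := Wfree vW.
have deg2 : 1 < indeg W v.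
  have : 0 < indeg W v by apply/card_gt0P; exists j0; rewrite inE j0W.
  by case: (indeg W v) deg => [|[]].
have lz j : j \in W -> A j v -> lit z j v by move=> jW a; rewrite (full_lit fz) // lv; case: (z o).
have lz' j : j \in W -> A j v -> ~~ lit z' j v.
  by move=> jW a; rewrite (full_lit fz') // lv zz' addbb.
have [j||] := @trim [set j in W | A j v] (fun j => sg j v) (o :: u) z.
- by rewrite inE => /andP[jW a]; apply/eqP/lz.
- exists j0; first by rewrite inE j0W.
  have ro := ready_run letter_o rz.
  have uo : up z o o = ~~ z o by rewrite upE eqxx full_flip.
  have j0K := Kpred vK j0W a0.
  rewrite /= hu // uo; have := lz _ j0W a0; rewrite /lit fz //.
  by case: (kap j0); case: (z o); case: (sg j0 v).
move=> w0 [e [eN sw0 sub0 notN le]]; have := eN; rewrite inE => /andP[eW ae].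
exists (rcons (rcons w0 e) v); split.
- rewrite all_rcons /= vW; apply/allP=> k /sub0; rewrite inE => /orP[/eqP->//|].
  exact: (allP uW).
- by rewrite !size_rcons ltnS; apply: leq_trans su.
have [a [b [aN bN ab]]] := card_gt1P deg2.
have [e' [e'W ae' ne']] : exists e', [/\ e' \in W, A e' v & e' != e].
  move: aN bN; rewrite !inE => /andP[aW aa] /andP[bW bb].
  by case: (eqVneq a e) => [E|n]; [exists b; rewrite -E eq_sym|exists a].
rewrite !run_rcons !upE eqxx -run_rcons (Ffalse ae) // -run_rcons (Ffalse ae') //.
rewrite (@litE _ z') ?lz' // run_notin // mem_rcons inE negb_or ne'.
by apply/negP=> /(allP notN) /=; rewrite inE e'W ae'.
Qed.

(** If [o] differs, it is not in [iso W], so some ancestor has at least two in-neighbours. Along a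
    path from it to [o], a vertex of in-degree one inherits agreement and any other is merged
    afresh. *)
Lemma sync_root x y : synced W x y ->
  exists w, [/\ all (mem W) w, size w < 3 * #|K| & run w x o = run w y o].
Proof.
move=> sxy; have K_gt0 : 0 < #|K| by rewrite (cardsD1 o) oK.
case: (eqVneq (x o) (y o)) => xyo; first by exists [::]; split=> //=; rewrite muln_gt0.
have [u [uK su hu]] := spread_pocket.
have uK' : all (mem K) u by apply: all_subset uK; apply: subsetDl.
have uW : all (mem W) u by apply: all_subset uK'.
have uo z : run u z o = z o by apply: run_out uK _; rewrite !inE eqxx.
have [_ rx ry _ e2] := sxy; have s1 := synced_run uW sxy.
have [_ rx1 ry1 e1 _] := s1.
have fx : full (run u x) by move=> k kK; rewrite uo hu.
have fy : full (run u y) by move=> k kK; rewrite uo hu.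
have xy1 : run u y o = ~~ run u x o.
  by rewrite !uo; move: xyo; case: (x o); case: (y o).
have meet v : v \in K -> indeg W v != 1 ->
    exists w, [/\ all (mem W) w, size w <= #|K|.+1 & run w (run u x) v = run w (run u y) v].
  move=> vK deg; case: (eqVneq ((v == o) || kap v) (~~ run u x o)) => E.
    exact: merge_at.
  have [||w [h1 h2 h3]] := @merge_at (run u y) (run u x) v ry1 fy fx _ vK deg.
  - by rewrite xy1 negbK.
  - by rewrite xy1 negbK; move: E; case: (_ || _); case: (run u x o).
  by exists w; split.
have : o \notin iso W by apply: contra xyo => oI; rewrite e2.
rewrite inE oW /= => /forallPn[b]; rewrite negb_imply => /andP[/andP[bW cbo] degb].
have {}cbo : connect (restr K A) b o.
  by apply: restr_closed cbo oK => a k aW kK; apply: Kpred.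
have bK := connect_restr_l cbo oK.
case/connectP: cbo => p pp lp; case/shortenP: pp lp => {}p pp up _ lp.
have pK : all (mem K) (b :: p).
  rewrite /= bK; elim: p b pp {lp up bK bW degb} => //= c p IH b /andP[/and3P[_ -> _] /IH].
  by [].
have szp : size p < #|K|.
  rewrite -[(size p).+1]/(size (b :: p)); move/card_uniqP: up => <-.
  by apply/subset_leq_card/subsetP=> k /(allP pK).
have [w [wW sw ew]] : exists w, [/\ all (mem W) w, size w <= #|K|.+1 + size p &
    run w (run u x) (last b p) = run w (run u y) (last b p)].
  elim/last_ind: p pp {lp up pK szp} => [_|p v IH].
    by have [w [h1 h2 h3]] := meet b bK degb; exists w; split; rewrite ?addn0.
  rewrite rcons_path last_rcons => /andP[/IH[w [wW sw ew]] /and3P[v0K vK a]].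
  have vW := subsetP KW _ vK; have v0W := subsetP KW _ v0K.
  case: (eqVneq (indeg W v) 1) => deg; last first.
    have [w' [h1 h2 h3]] := meet v vK deg; exists w'; split=> //.
    by apply: leq_trans h2 _; rewrite leq_addr.
  exists (rcons w v); rewrite !size_rcons addnS ltnS all_rcons wW /= vW; split=> //.
  rewrite !run_rcons !upE eqxx; apply: F_eq => j aj.
  case: (boolP (j \in W)) => jW; last by rewrite !(run_out _ wW jW) e1.
  have /eqP/cards1P[q Eq] := deg.
  have uq i : i \in W -> A i v -> i = q by move=> iW ai; apply/set1P; rewrite -Eq inE iW.
  by rewrite (uq j) // -(uq _ v0W a).
exists (u ++ w); rewrite !run_cat lp; split=> //; first by rewrite all_cat uW.
rewrite size_cat; move: su sw szp; move: (size u) (size w) (size p) (#|K|).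
by clear=> *; lia.
Qed.

Lemma step_in x y : synced W x y -> steppable x y (6 * #|K| + 3 * newiso).
Proof.
move=> sxy; have K_gt0 : 0 < #|K| by rewrite (cardsD1 o) oK.
have [w1 [w1W sw1 e1]] := sync_root sxy.
have s1 := synced_run w1W sxy.
apply: (steppable_run w1W (N := 3 * #|K| + 3 * newiso)); last first.
  by move: sw1; move: (size w1) (#|K|) (newiso); clear=> *; lia.
move: (run w1 x) (run w1 y) s1 e1 => {sxy sw1 w1W w1} {}x {}y sxy xyo.
have [u [uK su hu]] := spread_pocket.
have uK' : all (mem K) u by apply: all_subset uK; apply: subsetDl.
have uW : all (mem W) u by apply: all_subset uK'.
have uo z : run u z o = z o by apply: run_out uK _; rewrite !inE eqxx.
(* A pocket that follows its root flips it at each update; [o] is brought to 1 here so that the next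
   update gives 0. *)
have [w2 [w2W sw2 h2]] : exists w2, [/\ all (mem W) w2, size w2 < 2 * #|K| &
    forall z, ready W z -> z o = x o -> run w2 z o = true /\ full (run w2 z)].
  case E: (x o).
    exists u; split=> //; first by apply: leq_trans su _; rewrite leq_pmull.
    by move=> z rz zo; rewrite uo zo; split=> // k kK; rewrite uo hu.
  exists (u ++ o :: u); split; first by rewrite all_cat uW /= oW.
    by rewrite size_cat /= addnS; move: su; move: (size u) (#|K|); clear=> *; lia.
  move=> z rz zo; rewrite run_cat /=.
  have fz : full (run u z) by move=> k kK; rewrite uo hu.
  have rz1 := ready_run uW rz.
  have zo1 : up (run u z) o o = true by rewrite upE eqxx full_flip // uo zo.
  rewrite uo zo1; split=> // k kK; rewrite uo hu //.
  exact: (ready_run letter_o rz1).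
apply: (steppable_run w2W (N := #|K|.+1 + 3 * newiso)); last first.
  by move: sw2; move: (size w2) (#|K|) (newiso); clear=> *; lia.
have [_ rx ry _ _] := sxy.
have [xo fx] := h2 x rx erefl; have [yo fy] := h2 y ry (esym xyo).
have s2 := synced_run w2W sxy.
move: (run w2 x) (run w2 y) s2 xo yo fx fy => {sxy sw2 w2W w2 h2 xyo rx ry} {}x {}y sxy xo yo fx fy.
have [_ rx ry _ _] := sxy.
have [|||w3 [Cs [w3W1 sw3 CsJ U0 hCs]]] :=
    @settle _ set0 x y (leqnn _) (sub0set _) rx ry.
- exact: fx.
- by move=> k kK; rewrite fy // yo addbT.
- by move=> c; rewrite inE.
have W1W : W1 \subset W by apply: subsetDl.
have w3W : all (mem W) w3 by apply: all_subset w3W1.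
have s3 := synced_run w3W sxy; have [_ rx3 ry3 _ _] := s3.
have KW1 k : k \in K -> k \notin W1 by rewrite inE => ->.
have run3 (z : st) k : k \in K -> run w3 z k = z k.
  by move=> kK; rewrite (run_out _ w3W1) // KW1.
have f3 z : full z -> full (run w3 z) by move=> fz k kK; rewrite (run3 _ _ kK) (run3 _ _ oK); apply: fz.
have s4 := synced_run letter_o s3.
have Co c : c \in Cs -> c != o.
  move/(subsetP CsJ)/isoW; rewrite inE => /andP[cK _].
  by apply: contraNneq cK => ->.
have [|||w [wW sw h]] := synced_pocket s4 _ _ CsJ U0.
- by rewrite /= upE eqxx full_flip ?run3 ?xo //; apply: f3.
- by rewrite /= upE eqxx full_flip ?run3 ?yo //; apply: f3.
- by move=> c cC; rewrite /= !upE (negbTE (Co _ cC)); have [-> ->] := hCs _ cC.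
apply: (steppable_run w3W (N := #|K|.+1 + newiso)).
  apply: (steppable_run letter_o (N := #|K| + newiso)).
    by exists w; split=> //; apply: ltnW.
  by rewrite addSn add1n.
move: sw3 unsettled0; move: (size w3) (#|unsettled _|) (#|K|) (newiso).
by clear=> *; lia.
Qed.

End ClosedPocket.

End Pocket.

(** * Merging pairs, then sets of states *)

Definition rounds := if [forall v, A v v] then 2 else 3.

Lemma shrink W x y : W != set0 -> synced W x y ->
  exists W1 w, [/\ W1 \proper W, all (mem W) w,
    size w <= rounds * runcost #|W|.-1 #|~: W|
              + 6 * (#|W| - #|W1|) + 3 * #|iso W1 :\: iso W|,
    synced W1 (run w x) (run w y) & iso W :&: W1 \subset iso W1].
Proof.
move=> W0 sxy; have [Wfree _ _ _ _] := sxy.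
have [o [K [kap [pk deg]]]] := pocket_exists W0 Wfree.
have [[oK KW _] _ _ W1free _] := pk.
have cK : #|W| - #|W :\: K| = #|K| by rewrite cardsD (setIidPr KW) subKn // subset_leq_card.
suff [w [wW sw h]] : steppable W K x y
    (rounds * runcost #|W|.-1 #|~: W| + 6 * #|K| + 3 * #|iso (W :\: K) :\: iso W|).
  exists (W :\: K), w; split=> //; last by apply: iso_sub => //; apply: subsetDl.
  - apply/properP; split; first exact: subsetDl.
    by exists o; rewrite ?(subsetP KW) // inE oK.
  - by rewrite cK.
case: deg => [Kcl|deg].
  have [w [wW sw h]] := step_in Wfree pk Kcl sxy; exists w; split=> //.
  by apply: leq_trans sw _; rewrite -addnA leq_addl.
have [w [wW sw h]] := step_out Wfree pk deg sxy; exists w; split=> //.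
apply: leq_trans sw _; rewrite leq_add2r leq_add ?leq_mul2r ?orbT //.
apply/orP; right; rewrite /rounds; case: forallP => [h1|]; first by rewrite h1.
by case: (A o o).
Qed.

(** Each removal is charged to the summand of index [#|W|.-1], and [#|W|] decreases strictly. Newly
    isolated vertices leave [W :\: iso W], which pays for the last term. *)
Lemma pair_merge W x y : synced W x y ->
  exists w, size w <= rounds * (\sum_(i < #|W|) runcost i (#|V|.-1 - i))
                      + 6 * #|W| + 3 * #|W :\: iso W| /\ run w x = run w y.
Proof.
move: {2}#|W| (leqnn #|W|) => m; elim: m W x y => [|m IH] W x y le sxy.
  move: le; rewrite leqn0 cards_eq0 => /eqP W0; exists [::]; split=> //.
  apply/ffunP=> k; have [_ _ _ e _] := sxy; by apply: e; rewrite W0 inE.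
case: (eqVneq W set0) => [W0|W0].
  exists [::]; split=> //; apply/ffunP=> k; have [_ _ _ e _] := sxy.
  by apply: e; rewrite W0 inE.
have [W1 [w [pW wW sw s1 isub]]] := shrink W0 sxy.
have lt := proper_card pW.
have [|w' [sw' e]] := IH W1 _ _ _ s1; first by rewrite -ltnS (leq_trans lt).
exists (w ++ w'); rewrite !run_cat; split=> //.
have WW1 := proper_sub pW.
have c1 : #|W1 :\: iso W1| + #|iso W1 :\: iso W| <= #|W :\: iso W|.
  have dis : (W1 :\: iso W1) :&: (iso W1 :\: iso W) = set0.
    by apply/setP=> k; rewrite in_setI !in_setD in_set0; case: (k \in iso W1); rewrite ?andbF.
  rewrite -[_ + _]subn0 -(cards0 V) -dis -cardsU; apply/subset_leq_card.
  rewrite subUset; apply/andP; split; apply/subsetP=> k; rewrite !in_setD.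
    move=> /andP[nI kW1]; rewrite (subsetP WW1) // andbT.
    by apply: contra nI => kI; apply: (subsetP isub); rewrite in_setI kI.
  by move=> /andP[-> /isoW/(subsetP WW1) ->].
have c2 : runcost #|W|.-1 #|~: W| + \sum_(i < #|W1|) runcost i (#|V|.-1 - i) <=
    \sum_(i < #|W|) runcost i (#|V|.-1 - i).
  have W_gt0 : 0 < #|W| by apply: leq_ltn_trans lt.
  rewrite -[in X in _ <= X](prednK W_gt0) big_ord_recr /= addnC leq_add //.
    have le1 : #|W1| <= #|W|.-1 by rewrite -ltnS prednK.
    rewrite -(big_mkord xpredT (fun i => runcost i (#|V|.-1 - i))).
    rewrite -(big_mkord xpredT (fun i => runcost i (#|V|.-1 - i))).
    by rewrite [X in _ <= X](big_cat_nat (n := #|W1|)) //= leq_addr.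
  apply: runcost_mono => //; move: W_gt0 (cardsC W).
  by move: (#|W|) (#|~: W|) (#|V|); clear=> *; lia.
rewrite size_cat; apply: leq_trans (leq_add sw sw') _.
have := subset_leq_card WW1; move: c1 c2.
set a := runcost _ _; set b := \sum_(i < #|W1|) _; set c := \sum_(i < #|W|) _.
move: (#|W|) (#|W1|) c1 => ? ?; move: (#|_|) (#|_|) (#|_|).
by rewrite /rounds; case: ifP => _; clear=> *; lia.
Qed.

Lemma merge_set L : (forall x y, exists2 w, size w <= L & run w x = run w y) ->
  forall X : {set st}, exists2 w, size w <= #|X|.-1 * L &
    forall x y, x \in X -> y \in X -> run w x = run w y.
Proof.
move=> merge X; move: {2}#|X| (leqnn #|X|) => m; elim: m X => [|m IH] X le.
  move: le; rewrite leqn0 cards_eq0 => /eqP->; exists [::] => // x y; by rewrite inE.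
case: (leqP #|X| 1) => [/card_le1_eqP le1|/card_gt1P[x [y [xX yX ne]]]].
  by exists [::] => // x y xX yX; rewrite (le1 x y).
have [w sw e] := merge x y; pose X' := [set run w z | z in X].
have sub : X' \subset [set run w z | z in X :\ x].
  apply/subsetP=> z' /imsetP[z zX ->]; case: (eqVneq z x) => [->|zx].
    by rewrite e imset_f // !inE eq_sym ne.
  by rewrite imset_f // !inE zx.
have cX : #|X'| < #|X|.
  rewrite [X in _ < X](cardsD1 x) xX ltnS; apply: leq_trans (subset_leq_card sub) _.
  exact: leq_imset_card.
have X'0 : 0 < #|X'| by apply/card_gt0P; exists (run w x); apply: imset_f.
have [|w' sw' e'] := IH X'; first by rewrite -ltnS (leq_trans cX).
exists (w ++ w').
  rewrite size_cat; apply: leq_trans (leq_add sw sw') _.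
  rewrite -mulSn leq_mul2r prednK // -ltnS prednK ?cX ?orbT //.
  exact: leq_ltn_trans cX.
by move=> u v uX vX; rewrite !run_cat; apply: e'; apply: imset_f.
Qed.

Let flipv i x : st := [ffun k => if k == i then ~~ x k else x k].

Let flipv_lit i x j k : lit (flipv i x) j k = lit x j k (+) (j == i).
Proof.
by rewrite /lit ffunE; case: (j == i) => //; case: (x j); case: (sg j k).
Qed.

Lemma flipvK i : involutive (flipv i).
Proof. by move=> x; apply/ffunP=> k; rewrite !ffunE; case: eqP => // _; rewrite negbK. Qed.

Lemma card_states : #|{: st}| = 2 ^ #|V|.
Proof. by rewrite card_ffun card_bool. Qed.

(** [F] at [i] ignores component [i], which an image state has equal to it; flipping [i] thus leaves
    the image. *)
Lemma image_loopless i : ~~ A i i -> 2 * #|[set up x i | x : st]| <= 2 ^ #|V|.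
Proof.
move=> nl; set X := [set _ | _ in _].
have FX x : F (flipv i x) i = F x i.
  apply: F_eq => j a; rewrite ffunE; case: eqP => // E.
  by move: nl; rewrite -{1}E a.
have XP z : z \in X -> z i = F z i.
  case/imsetP=> x _ ->; rewrite upE eqxx; apply: F_eq => j a; rewrite upE.
  by case: eqP => // E; move: nl; rewrite -{1}E a.
have dis : X :&: [set flipv i z | z in X] = set0.
  apply/setP=> z; rewrite in_setI in_set0; apply/negP=> /andP[zX /imsetP[z' z'X E]].
  have := XP _ zX; rewrite E FX ffunE eqxx (XP _ z'X).
  by case: (F z' i).
rewrite -card_states mul2n -addnn.
rewrite -[X in _ + X](card_imset (mem X) (inv_inj (flipvK i))).
by rewrite -[X in X <= _]subn0 -(cards0 st) -dis -cardsU max_card.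
Qed.

(** A state with [i] at 1 and a false literal from [e] is never an image; these states and their
    flips at [i], at [e] and at both cover everything. *)
Lemma image_loop i e : e != i -> A e i ->
  4 * #|[set up x i | x : st]| <= 3 * 2 ^ #|V|.
Proof.
move=> ei aei; pose C := [set z : st | z i && ~~ lit z e i].
have sub : [set up x i | x : st] \subset ~: C.
  apply/subsetP=> z /imsetP[x _ ->]; rewrite !inE upE eqxx negb_and negbK.
  case E: (F x i) => //=; rewrite (@litE _ x) ?upE ?(negbTE ei) //.
  by move: E => /forallP/(_ e); rewrite aei.
have cover : [set: st] \subset C :|: [set flipv i z | z in C]
    :|: ([set flipv e z | z in C] :|: [set flipv i (flipv e z) | z in C]).
  apply/subsetP=> z _; rewrite !in_setU.
  have mem_flip (f : st -> st) z' : z = f z' -> z' \in C -> z \in [set f y | y in C].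
    by move=> ->; apply: imset_f.
  case zi: (z i); case l: (lit z e i); apply/orP.
  - right; apply/orP; left; apply: (mem_flip _ (flipv e z)); first by rewrite flipvK.
    by rewrite inE flipv_lit eqxx l ffunE eq_sym (negbTE ei) zi.
  - by left; apply/orP; left; rewrite inE zi l.
  - right; apply/orP; right; apply: (mem_flip (fun y => flipv i (flipv e y)) (flipv e (flipv i z))).
      by rewrite !flipvK.
    by rewrite inE !flipv_lit eqxx l (negbTE ei) !ffunE eqxx eq_sym (negbTE ei) zi.
  - left; apply/orP; right; apply: (mem_flip _ (flipv i z)); first by rewrite flipvK.
    by rewrite inE flipv_lit (negbTE ei) l ffunE eqxx zi.
have cC : 2 ^ #|V| <= 4 * #|C|.
  rewrite -card_states -cardsT; apply: leq_trans (subset_leq_card cover) _.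
  have cU (B D : {set st}) : #|B :|: D| <= #|B| + #|D| by rewrite -cardsUI leq_addr.
  apply: leq_trans (cU _ _) _; apply: leq_trans (leq_add (cU _ _) (cU _ _)) _.
  rewrite (_ : 4 * #|C| = #|C| + #|C| + (#|C| + #|C|)); last by lia.
  by rewrite !leq_add // leq_imset_card.
have := subset_leq_card sub; have := cardsC C; rewrite card_states.
move: cC; move: (2 ^ _) (#|C|) (#|~: C|) (#|_|).
by clear=> *; lia.
Qed.

(** A loopless first letter leaves at most half of the states, with three runs per removal; with
    loops everywhere, three quarters but two runs. Both products are 3/2. *)
Lemma net_sync : 1 < #|V| -> iso setT = set0 ->
  exists w r M, [/\ forall x y, run w x = run w y,
    size w <= M * (r * (\sum_(i < #|V|) runcost i (#|V|.-1 - i)) + 9 * #|V|) &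
    (r = 3 /\ 2 * M <= 2 ^ #|V|) \/ (r = 2 /\ 4 * M <= 3 * 2 ^ #|V|)].
Proof.
move=> V2 iso0.
have pred i : exists2 e, e != i & A e i.
  have [u ui] : exists u, u != i.
    have := V2; rewrite -cardsT => /card_gt1P[a [b [_ _ ab]]].
    by case: (eqVneq a i) => [E|n]; [exists b; rewrite -E eq_sym|exists a].
  have [a [b [_ _ ab aI /negPn/eqP E]]] :=
    connect_cross (p := predC1 i) (strong u i) ui (introT negPn (eqxx i)).
  by exists a; rewrite // -E.
pose L := rounds * (\sum_(i < #|V|) runcost i (#|V|.-1 - i)) + 9 * #|V|.
have merge x y : exists2 w, size w <= L & run w x = run w y.
  have [|w [sw e]] := @pair_merge setT x y.
    split.
    - by move=> w _; have [e _ a] := pred w; exists e.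
    - by move=> j w; rewrite inE.
    - by move=> j w; rewrite inE.
    - by move=> k; rewrite inE.
    - by move=> k; rewrite iso0 inE.
  exists w => //; apply: leq_trans sw _; rewrite cardsT /L -addnA leq_add2l.
  by rewrite iso0 setD0 cardsT -mulnDl.
have L_gt0 : 0 < L by rewrite /L addn_gt0 orbC muln_gt0 (ltnW V2).
have main i : exists2 w, (forall x y, run w x = run w y) &
    size w <= #|[set up x i | x : st]| * L.
  have [w sw e] := merge_set merge [set up x i | x : st].
  exists (i :: w); first by move=> x y /=; apply: e; apply: imset_f.
  have X0 : 0 < #|[set up x i | x : st]|.
    by apply/card_gt0P; exists (up [ffun=> true] i); apply: imset_f.
  by rewrite /= -[X in _ <= X * _](prednK X0) mulSn -addn1 addnC leq_add.
rewrite /L /rounds in main; case: forallP main => [loops|nl] main.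
  have [i _] : exists i : V, true.
    by have := V2; rewrite -cardsT => /card_gt1P[i _]; exists i.
  have [e ei a] := pred i; have [w h sw] := main i.
  exists w, 2, #|[set up x i | x : st]|; split=> //; right; split=> //.
  exact: image_loop ei a.
have [i ni] : exists i, ~~ A i i.
  by apply: NNPP => n; apply: nl => i; apply: contraT => ni; case: n; exists i.
have [w h sw] := main i.
exists w, 3, #|[set up x i | x : st]|; split=> //; left; split=> //.
exact: image_loopless.
Qed.

End Net.

(** * Golden-ratio estimates *)

Section Golden.
Local Open Scope R_scope.

(* p is the golden ratio, and p * q = 2 makes the two alternatives in the
   recurrence of runcost balance. *)
Let p := (1 + sqrt 5) / 2.
Let q := sqrt 5 - 1.

Let sqrt5 : sqrt 5 * sqrt 5 = 5. Proof. by apply: sqrt_sqrt; lra. Qed.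
Let sqrt5_gt : 2.236 <= sqrt 5.
Proof. by have := sqrt_pos 5; move: sqrt5; nra. Qed.
Let sqrt5_lt : sqrt 5 <= 2.2361.
Proof. by move: sqrt5 sqrt5_gt; nra. Qed.
Let p2 : p * p = p + 1. Proof. by rewrite /p; lra. Qed.
Let pq : p * q = 2. Proof. by rewrite /p /q; lra. Qed.
Let pb : 1.618 <= p <= 1.61805. Proof. by rewrite /p; lra. Qed.
Let qb : 1.236 <= q <= 1.2361. Proof. by rewrite /q; lra. Qed.
Let p_pow k : 1 <= p ^ k. Proof. by apply: pow_R1_Rle; move: pb; lra. Qed.
Let q_pow k : 1 <= q ^ k. Proof. by apply: pow_R1_Rle; move: qb; lra. Qed.

Let powS (a : R) k : a ^ k.+1 = a * a ^ k. Proof. by []. Qed.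
Let p_fib k : p ^ k.+2 = p ^ k.+1 + p ^ k.
Proof. by rewrite !powS -Rmult_assoc p2; lra. Qed.

(** The term -2 absorbs the additive constants of both alternatives. *)
Lemma runcost_bound m t : INR (runcost m t) <= 2 * (p ^ m * q ^ t) - 2.
Proof.
elim/ltn_ind: m t => -[|[|m]] IH t; first by rewrite /=; have := q_pow t; lra.
  by rewrite [INR _]/= [p ^ 1]/=; have := q_pow t; move: pb; nra.
rewrite runcostS; have h1 := IH m.+1 (ltnSn _) t; have h0 := IH m (leqnSn _) t.
have INR2 : INR 2 = 2 by rewrite /=; lra.
have e1 : INR (runcost m.+1 t + runcost m t + 2) <= 2 * (p ^ m.+2 * q ^ t) - 2.
  by rewrite !plus_INR INR2 p_fib; move: h1 h0; lra.
rewrite /maxn; case: ifP => _ //.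
case: t {h1 h0 e1} => [|t].
  by have := p_pow m.+2; rewrite [INR 0]/= [q ^ 0]/=; lra.
have h := IH m.+1 (ltnSn _) t.
rewrite plus_INR mult_INR INR2 [INR 1]/=.
have -> : p ^ m.+2 * q ^ t.+1 = (p * q) * (p ^ m.+1 * q ^ t).
  by rewrite (powS p m.+1) (powS q t); ring.
by rewrite pq; lra.
Qed.

(** The sum of the bounds telescopes, because p^2 (p - q) = 1. *)
Lemma sum_runcost_bound n :
  INR (\sum_(i < n) runcost i (n.-1 - i)) + 2 * INR n <= 2 * (p * p) * (p ^ n - q ^ n).
Proof.
suff h k : (k <= n)%N -> INR (\sum_(i < k) runcost i (n.-1 - i)) + 2 * INR k <=
    2 * (p * p) * (p ^ k * q ^ (n - k) - q ^ n).
  by have := h n (leqnn n); rewrite subnn Rmult_1_r.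
elim: k => [|k IH] kn; first by rewrite big_ord0 subn0 /=; lra.
rewrite big_ord_recr /= plus_INR -/(INR k.+1) S_INR.
have := IH (ltnW kn); have := runcost_bound k (n.-1 - k).
have -> : (n - k = (n.-1 - k).+1)%N by lia.
have -> : (n - k.+1 = n.-1 - k)%N by lia.
set a := INR (runcost _ _); set b := INR (bigop _ _ _).
rewrite !powS.
set c := q ^ (n.-1 - k); set d := p ^ k.
have -> : 2 * (p * p) * (d * (q * c) - q ^ n) = 2 * p * (p * q) * (d * c) - 2 * (p * p) * q ^ n.
  by ring.
have -> : 2 * (p * p) * (p * d * c - q ^ n) = 2 * (p * (p * p)) * (d * c) - 2 * (p * p) * q ^ n.
  by ring.
have -> : p * (p * p) = 2 * p + 1 by rewrite p2 Rmult_plus_distr_l p2; lra.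
by rewrite pq; lra.
Qed.

Lemma length_bound_of n r M len : (0 < n)%N ->
  (len <= M * (r * (\sum_(i < n) runcost i (n.-1 - i)) + 9 * n))%N ->
  ((r = 3 /\ 2 * M <= 2 ^ n) \/ (r = 2 /\ 4 * M <= 3 * 2 ^ n))%N ->
  length_bound n len.
Proof.
move=> n_gt0 le hM; rewrite /length_bound.
have -> : sqrt 5 + 1 = 2 * p by rewrite /p; lra.
rewrite Rpow_mult_distr.
have {le} := le_INR _ _ (elimT leP le); rewrite !(mult_INR, plus_INR).
have -> : INR 9 = 9 by rewrite /=; lra.
have := sum_runcost_bound n; set S := INR (bigop _ _ _).
have S0 : 0 <= S by apply: pos_INR.
have M0 : 0 <= INR M by apply: pos_INR.
have n1 : 1 <= INR n by apply: (le_INR 1); apply/leP.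
have pn : INR n <= p ^ n.
  case: n n_gt0 {n1 S S0 hM} => // n _; elim: n => [|n IH].
    by rewrite /=; move: pb; lra.
  by rewrite S_INR p_fib; have := p_pow n; lra.
have qn : 1 + 0.236 * INR n <= q ^ n.
  elim: (n) => [|k IH]; first by rewrite /=; lra.
  rewrite S_INR powS; have := pos_INR k; move: qb; nra.
have pow2 : INR (2 ^ n) = 2 ^ n.
  elim: (n) => [|k IH]; first by [].
  by rewrite expnS mult_INR IH powS /=; lra.
rewrite p2 => hS hlen; apply: Rle_trans hlen _.
have T0 : 0 < 2 ^ n by apply: pow_lt; lra.
set T := 2 ^ n in T0 pow2 *; set P := p ^ n in pn hS *; set Q := q ^ n in qn hS *.
(* The decimals enclose [2 * (p * p)], that is 3 + sqrt 5. *)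
have hS1 : S + 2 * INR n <= 5.2362 * P - 5.236 * Q.
  apply: Rle_trans hS _; move: pb; have := q_pow n; have := p_pow n; rewrite -/P -/Q.
  by nra.
case: hM => -[-> hM]; have := le_INR _ _ (elimT leP hM); rewrite !mult_INR pow2.
  have -> : INR 2 = 2 by rewrite /=; lra.
  have -> : INR 3 = 3 by rewrite /=; lra.
  (* The constant 20 is 10 divided by the share 1/2 of the states; below, 40/3 is 10 divided by
     3/4. *)
  move=> hM'; have hL : 3 * S + 9 * INR n <= 20 * P by lra.
  apply: (Rle_trans _ (INR M * (20 * P))); first by apply: Rmult_le_compat_l.
  have := p_pow n; rewrite -/P; nra.
have -> : INR 2 = 2 by rewrite /=; lra.
have -> : INR 3 = 3 by rewrite /=; lra.
have -> : INR 4 = 4 by rewrite /=; lra.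
move=> hM'; have hL : 2 * S + 9 * INR n <= 40 / 3 * P by lra.
apply: (Rle_trans _ (INR M * (40 / 3 * P))); first by apply: Rmult_le_compat_l.
have := p_pow n; rewrite -/P; nra.
Qed.

Lemma length_bound_le1 n len : (len <= 1)%N -> length_bound n len.
Proof.
move=> le; rewrite /length_bound.
have : INR len <= 1 by apply: (le_INR _ 1); apply/leP.
have : 1 <= (sqrt 5 + 1) ^ n by apply: pow_R1_Rle; move: sqrt5_gt; lra.
by lra.
Qed.

End Golden.

(** * Signed cycles and the networks on them *)

Section Walks.
Variable T : Type.
Implicit Types (e : rel T) (p : seq T).

Lemma path_zip e x p y :
  path e x (rcons p y) -> all (fun q => e q.1 q.2) (zip (x :: p) (rcons p y)).
Proof. by elim: p x => [|z p IH] x /= /andP[-> // /IH]. Qed.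

Lemma odd_changes (X : pred T) x p y :
  odd (count (fun q => X q.1 (+) X q.2) (zip (x :: p) (rcons p y))) = X x (+) X y.
Proof.
elim: p x => [|z p IH] x /=; first by rewrite addn0; case: (_ (+) _).
by rewrite oddD IH oddb; case: (X x); case: (X z); case: (X y).
Qed.

End Walks.

Section Cycles.
Variable n : nat.
Implicit Types (E : sdigraph n) (sgn : 'I_n -> 'I_n -> bool).

Definition signed_cycle sgn x p :=
  [seq (q.1, sgn q.1 q.2) | q <- zip (x :: p) (rcons p x)].

Lemma signed_cycle_fst sgn x p : map fst (signed_cycle sgn x p) = x :: p.
Proof. by rewrite -map_comp -/unzip1 unzip1_zip // size_rcons. Qed.

Lemma signed_cycle_arcs sgn x p : cycle_arcs (signed_cycle sgn x p) =
  [seq (q.1, q.2, sgn q.1 q.2) | q <- zip (x :: p) (rcons p x)].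
Proof.
set c := signed_cycle sgn x p.
have -> : cycle_arcs c = [seq (q.1.1, q.2, q.1.2) | q <- zip c (rot 1 (map fst c))].
  rewrite /cycle_arcs -map_rot; elim: (c) (rot 1 c) => [|u s IH] [|v t] //=.
  by rewrite IH.
rewrite signed_cycle_fst rot1_cons /c /signed_cycle.
elim: (x :: p) (rcons p x) => [|u s IH] [|v t] //=.
by rewrite IH.
Qed.

(** By strong connectivity the orbit of [v] under the in-neighbour map [pi] is a cycle through all
    vertices; it is reversed, as arcs go from [pi i] to [i]. *)
Lemma in_degree_one_cycle E (pi : 'I_n -> 'I_n) (v : 'I_n) : strongly_connected E ->
  (forall j i, (j, i, true) \in E -> (j, i, false) \in E -> False) ->
  (forall j i, adj E j i = (j == pi i)) -> graph_is_cycle E.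
Proof.
move=> strong single Epi.
have conn u w : fconnect pi u w.
  rewrite (eq_connect (e' := [rel a b | adj E b a])).
    by rewrite connect_rev /=; apply: strong.
  by move=> a b /=; rewrite Epi eq_sym.
have := (orbitPcycle 2 0).1 (conn (pi v) v).
rewrite -[orbit pi v]revK rev_cycle.
have ol w : w \in rev (orbit pi v) by rewrite mem_rev -fconnect_orbit.
have ou : uniq (rev (orbit pi v)) by rewrite rev_uniq orbit_uniq.
case: (rev _) ol ou => [|x p] ol ou; first by have := ol v.
rewrite /cycle => cp.
have arc q : q \in zip (x :: p) (rcons p x) -> q.1 = pi q.2.
  by move=> qz; apply/esym/eqP; apply: (allP (path_zip cp) q qz).
pose s j i := (j, i, true) \in E.
have inE' j i : adj E j i -> (j, i, s j i) \in E.
  by rewrite /adj /s; case h: (_ \in E).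
exists (signed_cycle s x p); split; last by move=> w; rewrite signed_cycle_fst.
  apply/and3P; split; first by rewrite /signed_cycle; case: (p).
    by rewrite signed_cycle_fst.
  rewrite signed_cycle_arcs all_map; apply/allP=> q qz /=; apply: inE'.
  by rewrite Epi (arc q qz).
apply/setP=> -[[j i] b]; rewrite inE signed_cycle_arcs; apply/idP/mapP.
  move=> jiE; have iz : i \in unzip2 (zip (x :: p) (rcons p x)).
    by rewrite unzip2_zip ?size_rcons // mem_rcons.
  have /mapP[q qz qi] := iz; exists q => //.
  have qj : q.1 = j.
    apply: etrans (arc q qz) _; apply/esym/eqP; rewrite -qi -Epi /adj.
    by case: b jiE => ->; rewrite ?orbT.
  rewrite qj -qi /s; case: b jiE => jiE; first by rewrite jiE.
  by case h: (_ \in E) => //; case: (single j i).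
case=> q qz [-> -> ->]; apply: inE'; rewrite Epi; exact/eqP/arc.
Qed.

Section CycleGraph.
Variables (E : sdigraph n) (c : seq ('I_n * bool)).
Hypotheses (cU : uniq (map fst c)) (cV : forall v, v \in map fst c).
Hypothesis EE : E = [set a in cycle_arcs c].

Lemma cycle_pred : exists (pi : 'I_n -> 'I_n) (b : 'I_n -> bool),
  forall j i s, ((j, i, s) \in E) = ((j == pi i) && (s == b i)).
Proof.
have szr : size (rot 1 c) = size c by rewrite size_rot.
have h i : exists jb : 'I_n * bool, forall j s,
    ((j, i, s) \in E) = ((j == jb.1) && (s == jb.2)).
  have ir : i \in map fst (rot 1 c) by rewrite map_rot mem_rot cV.
  have ur : uniq (map fst (rot 1 c)) by rewrite map_rot rot_uniq.
  pose k := index i (map fst (rot 1 c)).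
  have kc : k < size c by rewrite -szr -(size_map fst) index_mem.
  have [d _] : exists d, d \in c by case: (c) kc => // d c' _; exists d; rewrite mem_head.
  have ki : (nth d (rot 1 c) k).1 = i.
    by rewrite -(nth_map d d.1 fst) ?szr // nth_index.
  exists (nth d c k) => j s; rewrite EE inE; apply/mapP/andP.
    case=> -[u v] /(nthP (d, d))[k']; rewrite size_zip szr minnn => k'c.
    rewrite nth_zip ?szr // => -[<- <-] [-> iE ->].
    suff -> : k = k' by rewrite !eqxx.
    rewrite /k iE -(nth_map d d.1 fst) ?szr // index_uniq // size_map szr.
    exact: k'c.
  case=> /eqP-> /eqP->; exists (nth d c k, nth d (rot 1 c) k) => /=; last by rewrite ki.
  by rewrite -nth_zip ?szr // mem_nth // size_zip szr minnn.
have [f hf] := fin_all_exists h.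
by exists (fun i => (f i).1), (fun i => (f i).2) => j i s; rewrite hf.
Qed.

End CycleGraph.

Lemma flipK (x : state n) j : flip (flip x j) j = x.
Proof. by apply/ffunP=> k; rewrite !ffunE; case: eqP => // _; rewrite negbK. Qed.

(** Flipping a component that has no arc to [i] never changes [f] at [i], which thus depends on
    [pi i] alone; a witness of the only arc fixes how. *)
Lemma cycle_network E (f : BN n) (pi : 'I_n -> 'I_n) (b : 'I_n -> bool) : BN_on E f ->
  (forall j i s, ((j, i, s) \in E) = ((j == pi i) && (s == b i))) ->
  forall x i, f x i = (x (pi i) == b i).
Proof.
move=> fE Epi.
have indep (x : state n) k i : k != pi i -> f (flip x k) i = f x i.
  move=> ki; have [] := fE k i; rewrite !Epi (negbTE ki) /= => -[_ np] [_ nn].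
  have npos (y : state n) : y k = false -> f y i = false -> f (flip y k) i = false.
    by move=> yk fy; apply/negP=> fy'; apply/notF/np; exists y.
  have nneg (y : state n) : y k = false -> f y i = true -> f (flip y k) i = true.
    by move=> yk fy; apply/negPn/negP=> /negbTE fy'; apply/notF/nn; exists y.
  have low (y : state n) : y k = false -> f (flip y k) i = f y i.
    by move=> yk; case E1: (f y i); [apply: nneg|apply: npos].
  case xk: (x k); last exact: low.
  by have := low (flip x k); rewrite flipK ffunE eqxx xk => ->.
have agree (x y : state n) i : x (pi i) = y (pi i) -> f x i = f y i.
  move: {2}#|_| (leqnn #|[set k | x k != y k]|) => m.
  elim: m x => [|m IH] x le xy.
    congr (f _ i); apply/ffunP=> k; apply/eqP; apply: contraT => ne.
    move: le; rewrite leqn0 cards_eq0 => /eqP h.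
    by have := in_set0 k; rewrite -h inE ne.
  case: (set_0Vmem [set k | x k != y k]) => [h|[k]].
    by apply: IH => //; rewrite h cards0.
  rewrite inE => nk; have ki : k != pi i by apply: contraNneq nk => ->; rewrite xy.
  rewrite -(indep x k i ki); apply: IH; last by rewrite ffunE eq_sym (negbTE ki).
  rewrite -ltnS; apply: leq_trans le; apply/proper_card/properP; split.
    by apply/subsetP=> k'; rewrite !inE ffunE; case: (eqVneq k' k) => // ->.
  by exists k; rewrite !inE // ffunE eqxx; move: nk; case: (x k); case: (y k).
move=> x i; have [[hp _] [hn _]] := fE (pi i) i.
case bi: (b i).
  have [|y [y0 [fy0 fy1]]] := hp; first by rewrite Epi bi !eqxx.
  case xi: (x (pi i)).
    by apply: etrans fy1; apply: agree; rewrite ffunE eqxx y0 xi.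
  by apply: etrans fy0; apply: agree; rewrite y0 xi.
have [|y [y0 [fy0 fy1]]] := hn; first by rewrite Epi bi !eqxx.
case xi: (x (pi i)).
  by apply: etrans fy1; apply: agree; rewrite ffunE eqxx y0 xi.
by apply: etrans fy0; apply: agree; rewrite y0 xi.
Qed.

(** Words commute with complementation too, so a constant value would be its own complement. *)
Lemma complement_not_sync (f : BN n) (v : 'I_n) :
  (forall (x : state n) i, f [ffun k => ~~ x k] i = ~~ f x i) -> ~ synchronizing f.
Proof.
move=> fC [w [c hw]].
have fwC (x : state n) : fword f w [ffun k => ~~ x k] = [ffun k => ~~ fword f w x k].
  elim: w x {hw} => [//|i w IH] x.
  rewrite -[LHS]/(fword f w (upd f i _)) -[fword f _ x]/(fword f w (upd f i x)).
  rewrite -IH; congr fword; apply/ffunP=> k; rewrite !ffunE fC.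
  by case: eqP.
have := fwC [ffun => true]; rewrite !hw => /ffunP/(_ v).
by rewrite ffunE; case: (c v).
Qed.

(** Provides the instance on which the second alternative fails for a cycle. *)
Lemma cycle_and_net E (pi : 'I_n -> 'I_n) (b : 'I_n -> bool) :
  (forall j i s, ((j, i, s) \in E) = ((j == pi i) && (s == b i))) ->
  exists f : BN n, and_or_net E f.
Proof.
move=> Epi; pose f : BN n := fun x => [ffun i => [forall j,
  (((j, i, true) \in E) ==> x j) && (((j, i, false) \in E) ==> ~~ x j)]].
exists f; split; last by move=> i; left => x; rewrite ffunE.
have fE (x : state n) i : f x i = (x (pi i) == b i).
  rewrite ffunE; apply/forallP/eqP => [/(_ (pi i))|h j]; rewrite !Epi.
    by rewrite eqxx /=; case: (b i); rewrite /= ?andbT // => /negbTE.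
  by case: eqP => //= ->; rewrite h; case: (b i).
have flipne (x : state n) j i : f (flip x j) i != f x i -> j = pi i.
  by rewrite !fE ffunE; case: (eqVneq (pi i) j) => // _; rewrite eqxx.
move=> j i; rewrite !Epi; split; split.
- move=> /andP[/eqP-> /eqP bi]; exists [ffun=> false].
  by rewrite !fE !ffunE eqxx -bi.
- case=> x [xj [f0 f1]]; have E1 : j = pi i by apply: (flipne x); rewrite f0 f1.
  by rewrite E1 eqxx /=; move: f0; rewrite fE -E1 xj; case: (b i).
- move=> /andP[/eqP-> /eqP bi]; exists [ffun=> false].
  by rewrite !fE !ffunE eqxx -bi.
- case=> x [xj [f0 f1]]; have E1 : j = pi i by apply: (flipne x); rewrite f0 f1.
  by rewrite E1 eqxx /=; move: f0; rewrite fE -E1 xj; case: (b i).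
Qed.

End Cycles.

(** * Switching an and-or-net to conjunctions *)

Section AndOrNet.
Variables (n : nat) (E : sdigraph n) (f : BN n) (a : 'I_n -> bool).
Hypotheses (fE : BN_on E f)
  (fa : forall i, if a i then conj_at E f i else disj_at E f i).

(** With both literals of [j], a conjunction is constantly 0 and a disjunction constantly 1, so
    neither has an arc. *)
Lemma and_or_single j i : (j, i, true) \in E -> (j, i, false) \in E -> False.
Proof.
move=> pE nE; have [[hp _] _] := fE j i; have [x [_ [f0 f1]]] := hp pE.
have := fa i; case: (a i) => h.
  by move: f1; rewrite h => /forallP/(_ j); rewrite pE nE /=; case: (flip x j j).
by move: f0; rewrite h => /negbT/existsPn/(_ j); rewrite pE nE /=; case: (x j).
Qed.

Let s j i := (j, i, true) \in E.
(** Complementing a disjunction complements its literals, hence [a i]; [a j] is the switch of [j]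
    itself. *)
Let sg j i := (s j i == a i) == a j.
(* The switched state, in which every local function becomes a conjunction. *)
Definition switch (x : state n) : state n := [ffun i => x i == a i].

Lemma switch_F x i : F (adj E) sg (switch x) i = (f x i == a i).
Proof.
have litE' j : adj E j i ==> lit sg (switch x) j i =
    (s j i ==> (x j == a i)) && (((j, i, false) \in E) ==> (x j != a i)).
  rewrite /adj /lit /sg ffunE -/(s j i); have := @and_or_single j i; rewrite -/(s j i).
  case: (s j i) => /=; case: (_ \in E) => /=.
  - by move=> h; case: h.
  - by move=> _; case: (x j); case: (a i); case: (a j).
  - by move=> _; case: (x j); case: (a i); case: (a j).
  - by [].
rewrite /F (eq_forallb litE'); have := fa i; case: (a i) => -> /=.
  rewrite eqb_id; apply: eq_forallb => j; rewrite /s.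
  by congr (_ && _); case: (x j).
rewrite eqbF_neg negb_exists; apply: eq_forallb => j; rewrite negb_or !negb_and -!implybE.
by congr (_ && _); case: (x j).
Qed.

Lemma switch_run w x : switch (fword f w x) = run (adj E) sg w (switch x).
Proof.
elim: w x => [//|i w IH] x.
rewrite -[fword f _ x]/(fword f w (upd f i x)) IH /=; congr (run _ _ w _).
apply/ffunP=> k; rewrite upE switch_F !ffunE.
by case: (eqVneq k i) => [->|_].
Qed.

Lemma switch_inj : injective switch.
Proof.
move=> x y /ffunP h; apply/ffunP=> k; have := h k; rewrite !ffunE.
by case: (x k); case: (y k); case: (a k).
Qed.

(** A consistent arc is negative exactly when [X] changes along it. Around a cycle the number of
    changes is even, so the cycle would be positive. *)
Lemma consistent_acyclic : no_positive_cycle E ->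
  forall g j i, con (adj E) sg g j i -> connect (con (adj E) sg g) i j -> False.
Proof.
move=> npc g j i cji /connectP[p]; case/shortenP=> {}p pp up _ lp.
have cp : path (con (adj E) sg g) i (rcons p i) by rewrite rcons_path pp -lp.
have arcs := allP (path_zip cp).
pose X k := g k == a k.
have sX u v : con (adj E) sg g u v -> s u v = ~~ (X u (+) X v).
  move=> /andP[_]; rewrite /lit /sg /X.
  by case: (s u v); case: (g u); case: (g v); case: (a u); case: (a v).
have cyc : is_cycle E (signed_cycle s i p).
  apply/and3P; split; first by rewrite /signed_cycle; case: (p).
    by rewrite signed_cycle_fst.
  rewrite signed_cycle_arcs all_map; apply/allP=> q /arcs /andP[+ _] /=.
  by rewrite /adj -/(s _ _); case h: (s _ _); rewrite -topredE /= ?h //; case: (_ \in E).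
have := npc _ cyc; rewrite /positive_cycle /signed_cycle count_map.
rewrite (eq_in_count (a2 := fun q => X q.1 (+) X q.2)).
  by rewrite odd_changes addbb.
by move=> q /arcs /sX /= ->; rewrite negbK.
Qed.

(** Every vertex is an ancestor of [v], so all in-degrees are one. *)
Lemma iso_cycle : strongly_connected E -> iso (adj E) setT != set0 -> graph_is_cycle E.
Proof.
move=> strong /set0Pn[v]; rewrite inE => /andP[_ /forallP h].
have deg (i : 'I_n) : exists j0 : 'I_n, forall j, adj E j i = (j == j0).
  have := h i; rewrite inE /= (_ : connect _ i v) /=; last first.
    by apply: connect_sub_rel (strong i v) => b c; rewrite /restr !inE.
  move=> /cards1P[j0 Ej]; exists j0 => j.
  by have := in_set1 j j0; rewrite -Ej !inE.
have [pi Epi] : exists pi : 'I_n -> 'I_n, forall i j, adj E j i = (j == pi i).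
  exact: fin_all_exists deg.
exact: (in_degree_one_cycle v strong (@and_or_single) (fun j i => Epi i j)).
Qed.

Lemma and_or_sync : strongly_connected E -> no_positive_cycle E -> ~ graph_is_cycle E ->
  exists w, synchronizing_word f w /\ length_bound n (size w).
Proof.
move=> strong npc ncyc.
have iso0 : iso (adj E) setT = set0.
  by apply/eqP; apply: contraT => /(iso_cycle strong).
case: (ltnP 1 n) => [n2|].
  have [|w [r [M [hw sw hM]]]] := net_sync (consistent_acyclic npc) strong _ iso0.
    by rewrite card_ord.
  exists w; split.
    exists (fword f w [ffun=> true]) => x; apply: switch_inj.
    by rewrite !switch_run; apply: hw.
  rewrite card_ord in sw hM.
  by apply: (length_bound_of (ltnW n2) sw hM).
(* With at most one vertex, an arc would be a loop and the graph a cycle; so there is none and [f]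
   is constant. *)
move=> n1; have all_eq (i j : 'I_n) : i = j.
  by apply: ord_inj; move: (ltn_ord i) (ltn_ord j) n1; lia.
have noarc j i : adj E j i = false.
  apply/negP=> aji; apply: ncyc; apply: (in_degree_one_cycle (pi := id) i) => //.
    exact: and_or_single.
  by move=> u v; rewrite (all_eq u j) (all_eq v i) aji (all_eq j i) eqxx.
have fxa x i : f x i = a i.
  by apply/eqP; rewrite -switch_F Ftrue // => j; rewrite noarc.
have settled w (x : state n) k : k \in w \/ x k = a k -> fword f w x k = a k.
  elim: w x => [|i w IH] x; first by case.
  rewrite inE => h; apply: IH; rewrite ffunE.
  by case: (eqVneq k i) h => [->|_] h; [right|].
exists (enum 'I_n); split.
  exists [ffun k => a k] => x; apply/ffunP=> k; rewrite ffunE; apply: settled.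
  by left; rewrite mem_enum.
by apply: length_bound_le1; rewrite size_enum_ord.
Qed.

End AndOrNet.

Theorem theorem1 (n : nat) (E : sdigraph n) :
  strongly_connected E -> no_positive_cycle E ->
  let C1 := graph_is_cycle E /\ (forall f : BN n, BN_on E f -> ~ synchronizing f) in
  let C2 := forall f : BN n, and_or_net E f ->
              exists w : seq 'I_n, synchronizing_word f w /\ length_bound n (size w) in
  (C1 /\ ~ C2) \/ (~ C1 /\ C2).
Proof.
move=> strong npc C1 C2.
case: (classic (graph_is_cycle E)) => [cyc|ncyc]; last first.
  right; split; first by case.
  move=> f [fE loc].
  have [a fa] : exists a : 'I_n -> bool,
      forall i, if a i then conj_at E f i else disj_at E f i.
    have h i : exists b : bool, if b then conj_at E f i else disj_at E f i.
      by case: (loc i) => h; [exists true|exists false].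
    exact: fin_all_exists h.
  exact: (and_or_sync fE fa strong npc ncyc).
have [c [/and3P[c0 cU _] EE cV]] := cyc.
have [pi [b Epi]] := cycle_pred cU cV EE.
have [v _] : exists v : 'I_n, v \in map fst c.
  by case: (c) c0 => // d c' _; exists d.1; rewrite mem_head.
have nosync f : BN_on E f -> ~ synchronizing f.
  move=> fE; apply: (complement_not_sync v) => x i.
  rewrite !(cycle_network fE Epi) ffunE.
  by case: (x (pi i)); case: (b i).
left; split; first by split.
move=> h; have [f fE] := cycle_and_net Epi; have [w [sw _]] := h f fE.
by apply: (nosync f fE.1); exists w.
Qed.
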